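(* Let $n,m\ge1$ be integers, $1\le p_0<\infty$, and suppose that $p_0<p_1,\dots,p_m<\infty$ with $\frac1{p_1}+\dots+\frac1{p_m}=\frac1p$. Then there is a constant $C$, independent of $\vec w$, $\vec f$ and $\mathcal{S}$, such that for every sparse family $\mathcal{S}$ in a dyadic grid, every $\vec w=(w_1,\dots,w_m)\in A_{\vec P/p_0}$ and all $f_i\in L^{p_i}(w_i)$, $i=1,\dots,m$, $$\|\mathcal{A}^{p_0}_{\mathcal{S}}(\vec f)\|_{L^p(\nu_{\vec w})}\le C\,[\vec w]_{A_{\vec P/p_0}}^{\max\left(1,\frac{(p_1/p_0)'}{p},\dots,\frac{(p_m/p_0)'}{p}\right)}\prod_{i=1}^m\|f_i\|_{L^{p_i}(w_i)} .$$
   Context: Dyadic grid: a collection $\mathscr{D}$ of axis-parallel cubes in $\mathbb{R}^n$ whose side lengths are integer powers of $2$, any two of which are nested or disjoint, and such that for each $j\in\mathbb{Z}$ those of side length $2^j$ partition $\mathbb{R}^n$. Sparse family: a collection $\mathcal{S}\subset\mathscr{D}$ for which there exist pairwise disjoint measurable sets $E_Q\subset Q$ ($Q\in\mathcal{S}$) with $|Q|\le 2|E_Q|$. $\langle f\rangle_{Q,p_0}:=\big(\frac1{|Q|}\int_Q|f|^{p_0}\big)^{1/p_0}$ and $$\mathcal{A}^{p_0}_{\mathcal{S}}(\vec f)(x)=\sum_{Q\in\mathcal{S}}\Big[\prod_{i=1}^m\langle f_i\rangle_{Q,p_0}\Big]\chi_Q(x),\qquad \vec f=(f_1,\dots,f_m).$$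 A weight is a nonnegative locally integrable function on $\mathbb{R}^n$, positive a.e.; $\|f\|_{L^q(w)}=(\int|f|^qw\,dx)^{1/q}$. For $1<q<\infty$, $q'=q/(q-1)$. Put $\vec P=(p_1,\dots,p_m)$, $\vec P/p_0=(p_1/p_0,\dots,p_m/p_0)$ and $\nu_{\vec w}=\prod_{i=1}^m w_i^{p/p_i}$. The condition $\vec w\in A_{\vec P/p_0}$ means $$[\vec w]_{A_{\vec P/p_0}}:=\sup_Q\Big(\frac1{|Q|}\int_Q\nu_{\vec w}\Big)\prod_{i=1}^m\Big(\frac1{|Q|}\int_Qw_i^{1-(p_i/p_0)'}\Big)^{\frac{p/p_0}{(p_i/p_0)'}}<\infty,$$ the supremum being over all cubes $Q\subset\mathbb{R}^n$. *)

(* Defs.v *)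
From HB Require Import structures.
From mathcomp Require Import all_boot all_order all_algebra.
From mathcomp Require Import all_classical all_reals all_analysis.

Set Implicit Arguments.
Unset Strict Implicit.
Unset Printing Implicit Defensive.

Import Order.TTheory GRing.Theory Num.Theory.
Import numFieldNormedType.Exports.

Local Open Scope classical_set_scope.
Local Open Scope ring_scope.

Section LebesgueMeasure.
Context (R : realType).

Definition tcons n (z : n.-tuple (measurableTypeR R) * measurableTypeR R) :
    n.+1.-tuple (measurableTypeR R) := [tuple of z.2 :: z.1].

Lemma measurable_tcons n : measurable_fun [set: _] (@tcons n).
Proof. exact: measurable_cons. Qed.

Section step.
Context n (m : {measure set (n.-tuple (measurableTypeR R)) -> \bar R}).

Definition borel_lebesgueS :=
  pushforward (m \x @lebesgue_measure R)%E (@tcons n).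

HB.instance Definition _ := Measure.copy borel_lebesgueS
  (measure_function_pushforward__canonical__measure_function_Measure
    (m \x @lebesgue_measure R)%E (@measurable_tcons n)).

End step.

(* The n-fold product of the one-dimensional Lebesgue measure, on the Borel
   sets of R^n. *)
Fixpoint borel_lebesgue n :
    {measure set (n.-tuple (measurableTypeR R)) -> \bar R} :=
  if n is k.+1 then borel_lebesgueS (borel_lebesgue k)
  else \d_([tuple] : 0.-tuple (measurableTypeR R)).

Lemma measurable_box n (A : 'I_n -> set (measurableTypeR R)) :
  (forall i, measurable (A i)) ->
  measurable [set x : n.-tuple (measurableTypeR R) | forall i, A i (tnth x i)].
Proof.
move=> mA.
rewrite (_ : mkset _ = \big[setI/setT]_(i < n) ((@tnth n _)^~ i @^-1` A i)).
  apply: bigsetI_measurable => i _; rewrite -[X in measurable X]setTI.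
  exact: measurable_tnth.
apply/seteqP; split => x /= Ax.
  by elim/big_ind: _ => [//|P Q HP HQ|i _]; [split|exact: Ax].
by move=> i; move: Ax; rewrite (bigD1 i)//= => -[].
Qed.

Lemma borel_lebesgue_box n (A : 'I_n -> set (measurableTypeR R)) :
  (forall i, measurable (A i)) ->
  borel_lebesgue n [set x | forall i, A i (tnth x i)] =
  (\prod_(i < n) @lebesgue_measure R (A i))%E.
Proof.
elim: n A => [|n IH] A mA.
  by rewrite big_ord0 /= diracE mem_set// => -[].
rewrite big_ord_recl /= /borel_lebesgueS/= /pushforward.
rewrite (_ : _ @^-1` _ =
    [set x | forall i, A (lift ord0 i) (tnth x i)] `*` A ord0); last first.
  apply/seteqP; split; case=> x y /=.
    move=> H; split; last by have := H ord0; rewrite (tnth_nth 0).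
    by move=> i; have := H (lift ord0 i); rewrite tnthS.
  move=> [Hx Hy] i; case: (unliftP ord0 i) => [j|] ->; first by rewrite tnthS.
  by rewrite (tnth_nth 0).
rewrite [LHS]product_measure1E//; last first.
  by apply: (@measurable_box _ (fun i => A (lift ord0 i))) => i; exact: mA.
by rewrite (IH (fun i => A (lift ord0 i)))// muleC.
Qed.

(* R^n with its Lebesgue sigma-algebra, and the completed measure on it. *)
Definition Rn n := caratheodory_type (borel_lebesgue n)^*%mu.
HB.instance Definition _ n := Measurable.on (Rn n).

Definition leb n : set (Rn n) -> \bar R :=
  @completed_measure_extension _ _ _ (borel_lebesgue n).
HB.instance Definition _ n := Measure.on (@leb n).

End LebesgueMeasure.

Section Definitions.
Context (R : realType) (n : nat).
Implicit Types (Q : set (Rn R n)) (D S : set (set (Rn R n))) (p q l : R).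

(* Each face of a cube may be open or closed, so half-open, open and closed
   cubes are all covered. *)
Definition cube_of_side l Q :=
  exists (a : 'I_n -> R) (b c : 'I_n -> bool),
    Q = [set x | forall i, (tnth x i : R) \in
           Interval (BSide (b i) (a i)) (BSide (c i) (a i + l))].

Definition is_cube Q := exists2 l, 0 < l & cube_of_side l Q.

Lemma leb_cube l Q : 0 <= l -> cube_of_side l Q ->
  measurable Q /\ leb Q = (l ^+ n)%:E.
Proof.
move=> l0 [a [b [c ->]]].
pose A i : set (measurableTypeR R) :=
  [set` Interval (BSide (b i) (a i)) (BSide (c i) (a i + l))].
have mA i : measurable (A i) by exact: measurable_itv.
rewrite (_ : mkset _ = [set x | forall i, A i (tnth x i)])//.
split.
  by apply: sub_caratheodory; apply: sub_sigma_algebra; exact: measurable_box.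
rewrite /leb /completed_measure_extension [LHS]measurable_mu_extE; last first.
  exact: measurable_box.
rewrite borel_lebesgue_box//.
rewrite (eq_bigr (fun=> l%:E)) => [|i _].
  by rewrite prodEFin prodr_const card_ord.
rewrite /A lebesgue_measure_itv/= lte_fin ltrDl.
case: ltP => [_|]; first by rewrite -EFinD addrAC subrr add0r.
by move=> l0'; congr EFin; apply/eqP; rewrite eq_le l0 l0'.
Qed.

Definition dyadic_grid D :=
  [/\ forall Q, D Q -> exists j : int, cube_of_side (2 ^ j) Q,
      forall Q Q', D Q -> D Q' ->
        [\/ Q `<=` Q', Q' `<=` Q | Q `&` Q' = set0] &
      forall j : int,
        partition [set Q | D Q /\ cube_of_side (2 ^ j) Q] id [set: Rn R n]].

Definition sparse D S :=
  S `<=` D /\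
  exists E : set (Rn R n) -> set (Rn R n),
    [/\ forall Q, S Q -> measurable (E Q) /\ E Q `<=` Q,
        trivIset S E &
        forall Q, S Q -> (leb Q <= 2%:E * leb (E Q))%E].

(* Meant for nonnegative g. *)
Definition average Q (g : Rn R n -> R) : \bar R :=
  ((fine (leb Q))^-1%:E * \int[@leb R n]_(x in Q) (g x)%:E)%E.

Definition paverage p Q (f : Rn R n -> R) : \bar R :=
  (average Q (fun x => `|f x| `^ p)%R `^ p^-1%R)%E.

Definition sparse_operator m p0 S (f : 'I_m -> Rn R n -> R) (x : Rn R n) :
    \bar R :=
  (\esum_(Q in S) ((\prod_(i < m) paverage p0 Q (f i)) * (\1_Q x)%:E))%E.

(* Local integrability is integrability over every cube. *)
Definition weight (w : Rn R n -> R) :=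
  [/\ measurable_fun [set: Rn R n] w,
      forall x, 0 <= w x,
      {ae @leb R n, forall x, 0 < w x} &
      forall Q, is_cube Q -> (@leb R n).-integrable Q (EFin \o w)].

Definition weighted_norm q (w : Rn R n -> R) (g : Rn R n -> \bar R) : \bar R :=
  ((\int[@leb R n]_x (`|g x| `^ q * (w x)%:E)) `^ q^-1%R)%E.

Definition weighted_Lp q (w f : Rn R n -> R) :=
  measurable_fun [set: Rn R n] f /\ (weighted_norm q w (EFin \o f) < +oo)%E.

Definition conj_exp q : R := q / (q - 1).

Definition nu m p (P : 'I_m -> R) (w : 'I_m -> Rn R n -> R) (x : Rn R n) : R :=
  \prod_(i < m) w i x `^ (p / P i).

(* At a point where w i vanishes the negative power evaluates to 0 rather than
   +oo; for a weight this only happens on a null set. *)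
Definition A_const m p p0 (P : 'I_m -> R) (w : 'I_m -> Rn R n -> R) : \bar R :=
  ereal_sup [set (average Q (nu p P w) *
    \prod_(i < m) average Q (fun x => w i x `^ (1 - conj_exp (P i / p0)))%R `^
      (p / p0 / conj_exp (P i / p0))%R)%E | Q in [set Q | is_cube Q]].

End Definitions.

(* Main.v *)
(* Write [g_i = |f_i|^p0], [r_i = P_i / p0], [sigma_i = w_i^(1 - r_i')] and
   [t = min(1, p)]. For a finite part of the sparse family put
   [F = sum_Q a_Q 1_Q] with [a_Q = prod_i <g_i>_Q^(1/p0)]. Since [t <= 1],
   [F^p <= sum_Q a_Q^t 1_Q F^(p - t)], so that the p-th power of the norm of [F] is
   at most [sum_Q a_Q^t u_Q nu(Q)], where [u_Q] is the nu-average of [F^(p - t)] on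
   [Q]; this avoids duality and treats [p <= 1] and [p > 1] alike. With
   [lam_(i,Q) = int_Q g_i / sigma_i(Q)], the weight condition on [Q], the
   monotonicity of the weights from [E_Q] to [Q], and the lower bound for the weight
   functional on [E_Q] given by Hoelder's inequality for
   [nu^(p0/p) prod_i sigma_i^(1/r_i') = 1] yield
     a_Q^t u_Q nu(Q) <= C [w]^(b t) (u_Q^(1/(1 - t/p)) nu(E_Q))^(1 - t/p)
                          prod_i (lam_(i,Q)^(r_i) sigma_i(E_Q))^(t / P_i).
   The exponents on the right add up to 1. Hoelder's inequality for sums and the
   weighted dyadic Carleson embedding theorem then bound the sum by
   [C [w]^(b t) ||F||_p^(p - t) prod_i ||f_i||^t], and the finite power of [||F||_p]
   is cancelled. *)
Require Import Defs.
From mathcomp Require Import all_boot all_order all_algebra.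
From mathcomp Require Import all_classical all_reals all_analysis.
From mathcomp Require Import measurable_realfun ring lra.

Set Implicit Arguments.
Unset Strict Implicit.
Unset Printing Implicit Defensive.

Import Order.TTheory GRing.Theory Num.Theory.

Local Open Scope classical_set_scope.
Local Open Scope ring_scope.

(** * Weighted means and exponents *)

Lemma prodr_powR (R : realType) (I : Type) (s : seq I) (x : I -> R) (a : R) :
  (forall i, 0 <= x i) ->
  (\prod_(i <- s) x i) `^ a = \prod_(i <- s) x i `^ a.
Proof.
move=> x0; elim: s => [|i s IH]; first by rewrite !big_nil powR1.
by rewrite !big_cons powRM ?prodr_ge0// IH.
Qed.

Lemma powR_sum (R : realType) (I : Type) (s : seq I) (x : R) (a : I -> R) :
  0 < x -> x `^ (\sum_(i <- s) a i) = \prod_(i <- s) x `^ a i.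
Proof.
move=> x0; elim: s => [|i s IH]; first by rewrite !big_nil powRr0.
by rewrite !big_cons powRD ?IH// (gt_eqF x0) implybT.
Qed.

(** This is 1 + u <= exp u at u = x/A - 1, raised to the power [t]. When [A] is a weighted mean, the
    exponentials of several such bounds multiply to 1. *)
Lemma powR_le_expR (R : realType) (x A t : R) : 0 <= x -> 0 < A -> 0 <= t ->
  x `^ t <= A `^ t * expR ((x / A - 1) * t).
Proof.
move=> x0 A0 t0; rewrite -[X in X `^ t <= _](divfK (lt0r_neq0 A0)).
rewrite powRM ?divr_ge0 ?(ltW A0)// mulrC ler_wpM2l ?powR_ge0// expRM.
apply: ge0_ler_powR => //; rewrite ?nnegrE ?divr_ge0 ?expR_ge0 ?(ltW A0)//.
by apply: le_trans (expR_ge1Dx _); rewrite addrC subrK.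
Qed.

(** Polya's argument: with [A] the right-hand side, [powR_le_expR] bounds each factor; the powers of
    [A] multiply to [A] and the exponentials cancel, because the weights sum to 1. The pair [y],
    [t0] stays outside the family since it later carries the product weight, and the family the dual
    weights. *)
Lemma weighted_amgm (R : realType) (I : finType) (y t0 : R) (x t : I -> R) :
  0 <= y -> (forall i, 0 <= x i) -> 0 <= t0 -> (forall i, 0 <= t i) ->
  t0 + \sum_i t i = 1 ->
  y `^ t0 * \prod_i x i `^ t i <= t0 * y + \sum_i t i * x i.
Proof.
move=> y0 x0 t00 tge0 t1.
set A := t0 * y + _.
have S0 : 0 <= \sum_i t i * x i by apply: sumr_ge0 => i _; exact: mulr_ge0.
have A0 : 0 <= A by rewrite addr_ge0// mulr_ge0.
move: A0; rewrite le_eqVlt => /predU1P[/esym A0|A0]; last first.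
  have le1 : y `^ t0 * \prod_i x i `^ t i <=
      (A `^ t0 * expR ((y / A - 1) * t0)) *
      \prod_i (A `^ t i * expR ((x i / A - 1) * t i)).
    apply: ler_pM => //; rewrite ?powR_ge0 ?prodr_ge0//.
    - by move=> i _; exact: powR_ge0.
    - exact: powR_le_expR.
    - by apply: ler_prod => i _; rewrite powR_ge0 powR_le_expR.
  apply: (le_trans le1); rewrite big_split/= -powR_sum// -expR_sum.
  rewrite mulrACA -expRD -powRD ?(gt_eqF A0) ?implybT// t1 powRr1 ?(ltW A0)//.
  rewrite [X in expR X](_ : _ = 0) ?expR0 ?mulr1//.
  under eq_bigr => i _ do rewrite mulrBl mul1r mulrAC [_ * t i]mulrC.
  rewrite big_split/= -mulr_suml sumrN mulrBl mul1r mulrAC [y * t0]mulrC.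
  rewrite addrACA -mulrDl -/A divff ?(gt_eqF A0)// -opprD t1 subrr//.
(* The case [A = 0]. Some exponent is nonzero and its base must vanish, so the product is 0 in spite
   of the convention 0^0 = 1. *)
have [y00 S00] : t0 * y = 0 /\ \sum_i t i * x i = 0.
  by move/eqP: A0; rewrite paddr_eq0 ?mulr_ge0// => /andP[/eqP-> /eqP->].
rewrite A0; have [t0E|t0N] := eqVneq t0 0.
  have [i ti] : exists i, t i != 0.
    apply: contrapT => /forallNP H; move: t1; rewrite t0E add0r big1.
      by move/eqP; rewrite eq_sym oner_eq0.
    by move=> i _; apply/eqP; apply: contrapT => /negP; exact: H.
  have xi0 : x i = 0.
    move/eqP: S00; rewrite psumr_eq0 => [/allP/(_ i)|j _]; last exact: mulr_ge0.
    by rewrite mem_index_enum => /(_ isT)/=; rewrite mulf_eq0 (negbTE ti) => /eqP.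
  by rewrite (bigD1 i)//= xi0 powR0// mul0r mulr0.
move/eqP: y00; rewrite mulf_eq0 (negbTE t0N) => /eqP->.
by rewrite powR0// mul0r.
Qed.

(** Each sequence is divided by its sum, and [weighted_amgm] is applied to every term of the
    normalised sum; the weights then add up to 1. *)
Lemma holder_sum (R : realType) (J : eqType) (I : finType) (s : seq J)
    (y : J -> R) (x : I -> J -> R) (t0 : R) (t : I -> R) :
  (forall j, j \in s -> 0 <= y j) ->
  (forall i j, j \in s -> 0 <= x i j) ->
  0 <= t0 -> (forall i, 0 <= t i) -> t0 + \sum_i t i = 1 ->
  \sum_(j <- s) (y j `^ t0 * \prod_i x i j `^ t i) <=
  (\sum_(j <- s) y j) `^ t0 * \prod_i (\sum_(j <- s) x i j) `^ t i.
Proof.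
move=> y0 x0 t00 tge0 t1.
have normE (f : J -> R) (a : R) : (forall j, j \in s -> 0 <= f j) ->
    forall j, j \in s ->
    f j `^ a = (f j / \sum_(k <- s) f k) `^ a * (\sum_(k <- s) f k) `^ a.
  move=> f0 j js; have S0 : 0 <= \sum_(k <- s) f k.
    by rewrite big_seq sumr_ge0.
  rewrite -powRM ?divr_ge0 ?f0//.
  have [SE|SN] := eqVneq (\sum_(k <- s) f k) 0; last by rewrite divfK.
  rewrite SE mulr0; move/eqP: SE; rewrite big_seq psumr_eq0//.
  by move=> /allP/(_ j js); rewrite js => /eqP ->.
(* A vanishing sum makes every quotient 0, hence only an upper bound by 1. *)
have sum1 (f : J -> R) : (forall j, j \in s -> 0 <= f j) ->
    \sum_(j <- s) (f j / \sum_(k <- s) f k) <= 1.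
  move=> f0; rewrite -mulr_suml.
  have [->|SN] := eqVneq (\sum_(k <- s) f k) 0; first by rewrite mul0r ler01.
  by rewrite divff.
set Y := \sum_(j <- s) y j; pose X i := \sum_(j <- s) x i j.
rewrite -[leRHS]mul1r.
have -> : \sum_(j <- s) (y j `^ t0 * \prod_i x i j `^ t i) =
    (\sum_(j <- s) ((y j / Y) `^ t0 * \prod_i (x i j / X i) `^ t i)) *
    (Y `^ t0 * \prod_i X i `^ t i).
  rewrite mulr_suml big_seq [RHS]big_seq; apply: eq_bigr => j js.
  rewrite (normE y t0)// mulrACA -big_split/=; congr (_ * _).
  by apply: eq_bigr => i _; rewrite (normE (x i))// => k; exact: x0.
apply: ler_wpM2r.
  by rewrite mulr_ge0 ?powR_ge0// prodr_ge0// => i _; exact: powR_ge0.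
have Y0 : 0 <= Y by rewrite /Y big_seq sumr_ge0.
have X0 i : 0 <= X i by rewrite /X big_seq sumr_ge0// => j; exact: x0.
apply: (@le_trans _ _
    (\sum_(j <- s) (t0 * (y j / Y) + \sum_i t i * (x i j / X i)))).
  rewrite big_seq [leRHS]big_seq; apply: ler_sum => j js.
  by apply: weighted_amgm => //[|i]; rewrite divr_ge0// ?y0 ?x0.
rewrite big_split/= exchange_big/= -mulr_sumr -t1; apply: lerD.
  by rewrite ler_piMr// sum1.
apply: ler_sum => i _; rewrite -mulr_sumr ler_piMr// sum1// => j; exact: x0.
Qed.

(* With [A] the product [x * \prod_i s i `^ c i], the left-hand side is [A `^ B]
   times nonpositive powers of [x] and the [s i], so that replacing these by the
   smaller [y] and [z i] only increases it. *)
Lemma weight_exponents (R : realType) (I : finType) (x y K L B a : R)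
    (s z c e d : I -> R) :
  0 < y -> y <= x -> (forall i, 0 < z i) -> (forall i, z i <= s i) ->
  0 < L -> x * \prod_i s i `^ c i <= K -> L <= y * \prod_i z i `^ c i ->
  1 <= B -> a <= B -> (forall i, e i <= B * c i) ->
  (forall i, e i - d i = a * c i) ->
  x * \prod_i s i `^ e i <=
  L `^ (a - B) * K `^ B * (y `^ (1 - a) * \prod_i z i `^ d i).
Proof.
move=> y0 yx z0 zs L0 AK LA B1 aB eB ed.
have x0 : 0 < x by exact: lt_le_trans yx.
have s0 i : 0 < s i by exact: lt_le_trans (zs i).
have splitE (v : R) (u f g : I -> R) (k l : R) : 0 < v -> (forall i, 0 < u i) ->
    (forall i, f i = k * c i + g i) ->
    v `^ (k + l) * \prod_i u i `^ f i =
    (v * \prod_i u i `^ c i) `^ k * (v `^ l * \prod_i u i `^ g i).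
  move=> v0 u0 fE; rewrite powRM ?(ltW v0) ?prodr_ge0//; last first.
    by move=> i _; exact: powR_ge0.
  rewrite mulrACA -powRD ?(gt_eqF v0) ?implybT//; congr (_ * _).
  rewrite prodr_powR => [|i]; last exact: powR_ge0.
  rewrite -big_split/=; apply: eq_bigr => i _.
  by rewrite fE powRD ?(gt_eqF (u0 i)) ?implybT// -powRrM [c i * _]mulrC.
have prod0 (u f : I -> R) : 0 <= \prod_i u i `^ f i.
  by apply: prodr_ge0 => i _; exact: powR_ge0.
have anti (u v k : R) : 0 < u -> u <= v -> k <= 0 -> v `^ k <= u `^ k.
  move=> u0 uv k0; have v0 := lt_le_trans u0 uv.
  have E w : w `^ k = (w `^ (- k))^-1 by rewrite -powRN opprK.
  rewrite !E lef_pV2 ?posrE ?powR_gt0//.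
  by apply: ge0_ler_powR; rewrite ?nnegrE ?oppr_ge0// ltW.
rewrite -[X in X * \prod_i _]powRr1 ?(ltW x0)//.
rewrite -[X in x `^ X](subrKC B) (splitE _ _ _ (fun i => e i - B * c i))//; last first.
  by move=> i; rewrite subrKC.
apply: (@le_trans _ _ (K `^ B *
    (y `^ (1 - B) * \prod_i z i `^ (e i - B * c i)))).
  apply: ler_pM; rewrite ?powR_ge0 ?mulr_ge0 ?powR_ge0//.
    apply: ge0_ler_powR => //; first by rewrite (le_trans _ B1).
      by rewrite nnegrE mulr_ge0// ltW.
    by rewrite nnegrE (le_trans _ AK)// mulr_ge0// ltW.
  apply: ler_pM; rewrite ?powR_ge0//; first by rewrite anti// subr_le0.
  by apply: ler_prod => i _; rewrite powR_ge0 anti// subr_le0.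
rewrite -mulrA [leRHS]mulrCA; apply: ler_wpM2l; first exact: powR_ge0.
(* A second splitting, now at the smaller quantities, isolates the power [a - B] of a functional
   that is at least [L]; this exponent is nonpositive. *)
rewrite (_ : 1 - B = (a - B) + (1 - a)); last by ring.
rewrite (splitE _ _ _ d)// => [|i]; last first.
  by rewrite mulrBl -ed; ring.
apply: ler_wpM2r; first by rewrite mulr_ge0// powR_ge0.
by rewrite anti// subr_le0.
Qed.

(** Induction on [s]: a fraction z/A in [0, 1] is at most (z/A)^t, and the two fractions of A = x j
    + y add up to 1. *)
Lemma powR_sum_le (R : realType) (J : Type) (s : seq J) (x : J -> R) (t : R) :
  0 < t <= 1 -> (forall j, 0 <= x j) ->
  (\sum_(j <- s) x j) `^ t <= \sum_(j <- s) x j `^ t.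
Proof.
move=> /andP[t0 t1] x0; elim: s => [|j s IH].
  by rewrite !big_nil powR0// gt_eqF.
rewrite !big_cons; apply: le_trans (lerD (lexx _) IH).
set y := \sum_(k <- s) x k; have y0 : 0 <= y by exact: sumr_ge0.
have [A0|AN] := eqVneq (x j + y) 0.
  by rewrite A0 powR0 ?gt_eqF// addr_ge0 ?powR_ge0.
have A0 : 0 < x j + y by rewrite lt0r AN addr_ge0.
have part z : 0 <= z -> z <= x j + y ->
    z / (x j + y) * (x j + y) `^ t <= z `^ t.
  move=> z0 zA; rewrite -[X in _ <= X `^ t](divfK AN) powRM ?divr_ge0 ?(ltW A0)//.
  apply: ler_wpM2r; first exact: powR_ge0.
  move: z0; rewrite le_eqVlt => /predU1P[<-|z0].
    by rewrite mul0r powR0 ?gt_eqF.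
  by rewrite ger1_powR// divr_gt0//= ler_pdivrMr// mul1r.
have := lerD (part _ (x0 j) _) (part _ y0 _); rewrite lerDl lerDr x0 y0.
by rewrite -mulrDl -mulrDl divff// mul1r; apply.
Qed.

(** * The maximal function of a laminar family *)

Definition laminar (T : Type) (l : seq (set T)) :=
  forall A B, A \in l -> B \in l -> [\/ A `<=` B, B `<=` A | A `&` B = set0].

Lemma exists_minimal_set (T : Type) (l : seq (set T)) : l != [::] ->
  exists2 Q, Q \in l & forall A, A \in l -> A `<=` Q -> A = Q.
Proof.
elim: l => // B l IH _; have [->|/IH[Q Ql Qmin]] := eqVneq l [::].
  by exists B; rewrite ?mem_head// => A; rewrite inE => /eqP.
have [BQ|BQ] := pselect (B `<=` Q); last first.
  exists Q; rewrite ?inE ?Ql ?orbT// => A.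
  by rewrite inE => /predU1P[->|]; [|exact: Qmin].
exists B; rewrite ?mem_head// => A; rewrite inE => /predU1P[//|Al AB].
have AQ : A = Q by apply: Qmin => //; exact: subset_trans BQ.
by apply/seteqP; split => //; rewrite AQ.
Qed.

Lemma integral_setUC d (T : measurableType d) (R : realType)
    (mu : {measure set T -> \bar R}) (Q : set T) (f : T -> \bar R) :
  measurable Q -> measurable_fun [set: T] f -> (forall x, (0 <= f x)%E) ->
  (\int[mu]_x f x = \int[mu]_(x in Q) f x + \int[mu]_(x in ~` Q) f x)%E.
Proof.
move=> mQ mf f0; rewrite -ge0_integral_setU ?setUv//; first exact: measurableC.
by apply/disj_setPS => x [].
Qed.

(** Young's inequality for c^(s-1) lam with exponents s/(s-1) and s: the right side minus the left
    is s/(s-1) times its defect. *)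
Lemma powR_mean_slope (R : realType) (s c lam : R) : 1 < s -> 0 <= c -> 0 <= lam ->
  lam `^ s - c `^ s <= s / (s - 1) * (lam `^ s - c `^ (s - 1) * lam).
Proof.
move=> s1 c0 lam0; have s0 : 0 < s by rewrite (lt_trans _ s1).
have s10 : 0 < s - 1 by rewrite subr_gt0.
have := @conjugate_powR R (c `^ (s - 1)) lam (s / (s - 1)) s.
rewrite -powRrM mulrCA divff ?gt_eqF// mulr1 => /(_ (powR_ge0 _ _) lam0).
rewrite divr_gt0// s0 => /(_ isT isT).
rewrite invf_div => H; have {}H : c `^ (s - 1) * lam <=
    c `^ s * ((s - 1) / s) + lam `^ s / s.
  by apply: H; field; rewrite gt_eqF.
rewrite -subr_ge0.
have -> : s / (s - 1) * (lam `^ s - c `^ (s - 1) * lam) - (lam `^ s - c `^ s) =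
  s / (s - 1) * (c `^ s * ((s - 1) / s) + lam `^ s / s - c `^ (s - 1) * lam).
  by field; rewrite !gt_eqF.
by rewrite mulr_ge0 ?subr_ge0// divr_ge0// ltW.
Qed.

(** A dyadic maximal function over a finite family, where [lam Q] stands for the average over [Q].
    Keeping [lam] abstract lets it be a quotient of two integrals. *)
Definition maximal_average (R : realType) (T : Type) (lam : set T -> R)
    (l : seq (set T)) (x : T) : R :=
  \big[Num.max/0]_(Q <- l) (lam Q * \1_Q x).

Section maximal_average.
Context d (T : measurableType d) (R : realType).
Variable mu : {measure set T -> \bar R}.
Implicit Types (lam : set T -> R) (l : seq (set T)) (sg g : T -> R).

Lemma maximal_average_ge0 lam l x : 0 <= maximal_average lam l x.
Proof. exact: bigmax_ge_id. Qed.

Lemma maximal_average_cons lam Q l x :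
  maximal_average lam (Q :: l) x =
  Num.max (lam Q * \1_Q x) (maximal_average lam l x).
Proof. by rewrite /maximal_average big_cons. Qed.

Lemma le_maximal_average lam l Q x : Q \in l -> x \in Q ->
  lam Q <= maximal_average lam l x.
Proof.
move=> Ql xQ; apply: (@bigmax_sup_seq _ _ _ _ _ Q) => //.
by rewrite indicE xQ mulr1.
Qed.

Lemma measurable_maximal_average lam l :
  (forall Q, Q \in l -> measurable Q) ->
  measurable_fun [set: T] (maximal_average lam l).
Proof.
elim: l => [|Q l IH] ml.
  rewrite (_ : maximal_average lam [::] = cst 0)//.
  by apply/funext => x; rewrite /maximal_average big_nil.
rewrite (_ : maximal_average lam (Q :: l) =
    (fun x => lam Q * \1_Q x) \max maximal_average lam l); last first.
  by apply/funext => x; exact: maximal_average_cons.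
apply: measurable_maxr.
  by apply: measurable_funM => //; apply: measurable_indic; exact/ml/mem_head.
by apply: IH => A Al; apply: ml; rewrite inE Al orbT.
Qed.

(* The larger sets of the family either contain a minimal set or miss it. *)
Lemma maximal_average_const lam l Q : laminar (Q :: l) -> Q \notin l ->
  (forall A, A \in l -> A `<=` Q -> A = Q) -> (forall A, 0 <= lam A) ->
  exists2 c, 0 <= c & forall x, Q x -> maximal_average lam l x = c.
Proof.
move=> laml Ql Qmin lam0.
(* The constant is the largest [lam A] among the members that contain [Q]. *)
exists (\big[Num.max/0]_(A <- l | `[<Q `<=` A>]) lam A); first exact: bigmax_ge_id.
move=> x Qx; rewrite /maximal_average [RHS]bigmax_mkcond; apply: eq_big_seq => A Al.
rewrite indicE; case: asboolP => [QA|QA].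
  by rewrite mem_set ?mulr1//; exact: QA.
rewrite memNset ?mulr0// => Ax.
have AQl : A \in Q :: l by rewrite inE Al orbT.
have [//||] := laml Q A (mem_head _ _) AQl.
  by move=> AQ; move: Ql; rewrite -(Qmin A)// Al.
by move=> /seteqP[/(_ x) + _] => /(_ (conj Qx Ax)).
Qed.

(* Doob's inequality without level sets: on a minimal set [Q] the maximal function
   of the other sets is a constant [c], so that removing [Q] changes the two
   integrals by [(lam Q `^ s - c `^ s) * sg(Q)] and
   [(lam Q `^ (s - 1) - c `^ (s - 1)) * lam Q * sg(Q)], which [powR_mean_slope]
   compares. *)
Lemma maximal_average_ineq l sg g lam (s : R) : 1 < s ->
  uniq l -> laminar l ->
  (forall Q, Q \in l -> measurable Q) ->
  measurable_fun [set: T] sg -> (forall x, 0 <= sg x) ->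
  measurable_fun [set: T] g -> (forall x, 0 <= g x) ->
  (forall Q, 0 <= lam Q) ->
  (forall Q, Q \in l -> (\int[mu]_(x in Q) (sg x)%:E < +oo)%E) ->
  (forall Q, Q \in l -> (\int[mu]_(x in Q) (g x)%:E =
     (lam Q)%:E * \int[mu]_(x in Q) (sg x)%:E)%E) ->
  let M := maximal_average lam l in
  [/\ (\int[mu]_x (sg x * M x `^ s)%:E < +oo)%E,
      (\int[mu]_x (g x * M x `^ (s - 1))%:E < +oo)%E &
      (\int[mu]_x (sg x * M x `^ s)%:E <=
       (s / (s - 1))%:E * \int[mu]_x (g x * M x `^ (s - 1))%:E)%E].
Proof.
move=> s1 + + + msg sg0 mg g0 lam0.
have s0 : s != 0 by rewrite gt_eqF// (lt_trans _ s1).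
have s10 : s - 1 != 0 by rewrite gt_eqF// subr_gt0.
(* The induction is on a bound for the size, since the set removed is a minimal one and not the head
   of the list. *)
move: l => l; move: {2}(size l) (leqnn (size l)) => n.
elim: n l => [|n IH] l.
  rewrite leqn0 size_eq0 => /eqP -> _ _ _ _ _ M.
  have M0 x : M x = 0 by rewrite /M /maximal_average big_nil.
  under eq_integral do rewrite M0 powR0// mulr0.
  under [X in [/\ _, (X < _)%E & _]]eq_integral do rewrite M0 powR0// mulr0.
  under [X in (_ <= _ * X)%E]eq_integral do rewrite M0 powR0// mulr0.
  by rewrite !integral0 mule0.
have [->|l0] := eqVneq l [::].
  by move=> _; exact: (IH [::]).
move=> ln ul laml ml fsg gsg.
have [Q Ql Qmin] := exists_minimal_set l0.
set l' := rem Q l.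
have pl : perm_eq l (Q :: l') by exact: perm_to_rem.
have sub A : A \in l' -> A \in l by rewrite (perm_mem pl) inE => ->; rewrite orbT.
have Ql' : Q \notin l' by move: ul; rewrite (perm_uniq pl) => /andP[].
have [] := IH l'.
- by rewrite /l' size_rem//; move: ln; case: (size l).
- exact: rem_uniq.
- by move=> A B /sub + /sub; exact: laml.
- by move=> A /sub; exact: ml.
- by move=> A /sub; exact: fsg.
- by move=> A /sub; exact: gsg.
rewrite -/l'; set M' := maximal_average lam l' => M's M'g M'le M.
have ME x : M x = Num.max (lam Q * \1_Q x) (M' x).
  by rewrite -maximal_average_cons; exact: perm_big.
have [c c0 M'c] : exists2 c, 0 <= c & forall x, Q x -> M' x = c.
  apply: maximal_average_const => //.
    by move=> A B; rewrite -!(perm_mem pl); exact: laml.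
  by move=> A /sub; exact: Qmin.
have M'0 x : 0 <= M' x by exact: maximal_average_ge0.
(* If [lam Q] does not exceed [c], removing [Q] leaves the maximal function unchanged. Otherwise it
   equals [lam Q] on [Q] and is unchanged off [Q]. *)
have [lamc|clam] := leP (lam Q) c.
  rewrite (_ : M = M')//; apply/funext => x; rewrite ME indicE.
  case: (boolP (x \in Q)) => [/set_mem Qx|_]; last first.
    by rewrite mulr0; apply/max_idPr.
  by rewrite mulr1 M'c//; apply/max_idPr.
have MQ x : Q x -> M x = lam Q.
  move=> Qx; rewrite ME M'c// indicE mem_set// mulr1.
  by apply/max_idPl; exact: ltW.
have MNQ x : (~` Q) x -> M x = M' x.
  by move=> Qx; rewrite ME indicE memNset// mulr0; apply/max_idPr.
have mM : measurable_fun [set: T] M by exact: measurable_maximal_average.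
have mM' : measurable_fun [set: T] M'.
  by apply: measurable_maximal_average => A /sub; exact: ml.
have mp (h : T -> R) r : measurable_fun [set: T] h ->
    measurable_fun [set: T] (fun x => h x `^ r).
  by move=> mh; exact: (measurableT_comp (measurable_powR r)).
have mQ := ml _ Ql.
have splits (h k : T -> R) r : measurable_fun [set: T] h -> measurable_fun [set: T] k ->
    (forall x, 0 <= h x) -> forall b, 0 <= b -> (forall x, Q x -> k x = b) ->
    (\int[mu]_x (h x * k x `^ r)%:E =
     (b `^ r)%:E * \int[mu]_(x in Q) (h x)%:E +
     \int[mu]_(x in ~` Q) (h x * k x `^ r)%:E)%E.
  move=> mh mk h0 b b0 kb; rewrite (@integral_setUC _ _ _ _ Q)//; last 2 first.
    by apply/measurable_EFinP; apply: measurable_funM => //; exact: mp.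
    by move=> x; rewrite lee_fin mulr_ge0// powR_ge0.
  congr (_ + _)%E; rewrite -ge0_integralZl_EFin ?powR_ge0//.
  - by apply: eq_integral => x /set_mem Qx; rewrite kb// mulrC EFinM.
  - by move=> x _; rewrite lee_fin.
  - by apply/measurable_funTS/measurable_EFinP.
have Ceq (h : T -> R) r : (\int[mu]_(x in ~` Q) (h x * M x `^ r)%:E =
    \int[mu]_(x in ~` Q) (h x * M' x `^ r)%:E)%E.
  by apply: eq_integral => x /set_mem Qx; rewrite MNQ.
move: M's M'g M'le.
rewrite (splits sg M' s msg mM' sg0 c c0 M'c) (splits g M' (s - 1) mg mM' g0 c c0 M'c).
rewrite (splits sg M s msg mM sg0 _ (lam0 Q) MQ) (splits g M (s - 1) mg mM g0 _ (lam0 Q) MQ).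
rewrite !Ceq gsg//.
set S := (\int[mu]_(x in Q) (sg x)%:E)%E.
set A := (\int[mu]_(x in ~` Q) _)%E; set B := (\int[mu]_(x in ~` Q) (g _ * _)%:E)%E.
have S0 : (0 <= S)%E by apply: integral_ge0 => x _; rewrite lee_fin.
have A0 : (0 <= A)%E.
  by apply: integral_ge0 => x _; rewrite lee_fin mulr_ge0// powR_ge0.
have B0 : (0 <= B)%E.
  by apply: integral_ge0 => x _; rewrite lee_fin mulr_ge0// powR_ge0.
have Sf : S \is a fin_num by rewrite ge0_fin_numE//; exact: fsg.
move: S0 A0 B0; rewrite -(fineK Sf); move: (fine S) => S' S0.
(* The integrals [A] and [B] off [Q] are finite by the induction hypothesis. What remains is linear:
   the slope inequality times the mass of [Q], added to [H]. *)
move: A B => [A| |] [B| |]//; rewrite -?EFinM -?EFinD -?EFinM !ltry !lee_fin//.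
move=> A0 B0 _ _ H; split => //.
have := @powR_mean_slope R s c (lam Q) s1 c0 (lam0 Q).
have -> : lam Q `^ s = lam Q `^ (s - 1) * lam Q.
  by rewrite mulrC mulr_powRB1// (lt_trans _ s1).
set u := lam Q `^ (s - 1) in H *; set k := s / (s - 1) in H * => Hk.
have := ler_wpM2r S0 Hk; lra.
Qed.

End maximal_average.

(** * The Carleson embedding *)

(** Young's inequality with both coefficients enlarged to 1; it serves for the local integrability
    of [g] in the embedding below. *)
Lemma young_product (R : realType) (a b s : R) : 1 < s -> 0 <= a -> 0 <= b ->
  a `^ (1 - s^-1) * b `^ s^-1 <= a + b.
Proof.
move=> s1 a0 b0; have s0 : 0 < s by rewrite (lt_trans _ s1).
have si1 : s^-1 < 1 by rewrite invf_lt1.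
have t0 : 0 < 1 - s^-1 by rewrite subr_gt0.
have := @conjugate_powR R (a `^ (1 - s^-1)) (b `^ s^-1) (1 - s^-1)^-1 s.
rewrite -!powRrM divff ?gt_eqF// mulVf ?gt_eqF// !powRr1// !invrK.
rewrite !powR_ge0 invr_gt0 t0 s0 subrK => /(_ isT isT isT isT erefl)/le_trans; apply.
apply: lerD; first by rewrite ler_piMr// lerBlDr lerDl invr_ge0 ltW.
by rewrite ler_piMr// ltW.
Qed.

(** Young's inequality after moving a factor 2 onto the [h] term. The other term gets the
    coefficient 2^(-q) with q = s/(s-1) > 1, hence at most 1/2, and can be absorbed. *)
Lemma young_absorb (R : realType) (sg h M s : R) : 1 < s ->
  0 <= sg -> 0 <= h -> 0 <= M ->
  s / (s - 1) * (sg `^ (1 - s^-1) * h `^ s^-1 * M `^ (s - 1)) <=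
  2^-1 * (sg * M `^ s) + 2 `^ s / (s - 1) * h.
Proof.
move=> s1 sg0 h0 M0; have s0 : 0 < s by rewrite (lt_trans _ s1).
have s10 : 0 < s - 1 by rewrite subr_gt0.
have si1 : s^-1 < 1 by rewrite invf_lt1.
have t0 : 0 < 1 - s^-1 by rewrite subr_gt0.
set q := (1 - s^-1)^-1.
have qE : q = s / (s - 1) by rewrite /q; field; rewrite !gt_eqF.
have q1 : 1 < q by rewrite qE ltr_pdivlMr// mul1r gtrBl.
have := @conjugate_powR R (2 * h `^ s^-1)
  (2^-1 * (sg `^ (1 - s^-1) * M `^ (s - 1))) s q.
have -> : (2 * h `^ s^-1) `^ s = 2 `^ s * h.
  by rewrite powRM ?powR_ge0// -powRrM mulVf ?gt_eqF// powRr1.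
have -> : (2^-1 * (sg `^ (1 - s^-1) * M `^ (s - 1))) `^ q =
    2^-1 `^ q * (sg * M `^ s).
  rewrite powRM ?mulr_ge0 ?powR_ge0//; congr (_ * _).
  rewrite powRM ?powR_ge0// -!powRrM /q divff ?gt_eqF// powRr1// -/q.
  by rewrite qE mulrCA divff ?gt_eqF// mulr1.
rewrite !mulr_ge0 ?powR_ge0// s0 (lt_trans _ q1)// /q invrK subrKC -/q.
move=> /(_ isT isT isT isT erefl) H.
have half : 2^-1 `^ q <= 2^-1 :> R.
  by rewrite ge1r_powR ?(ltW q1)// invr_gt0 ltr0n/= invf_le1// ler1n.
rewrite -qE; have q0 : 0 < q by rewrite (lt_trans _ q1).
have {H}/(ler_wpM2l (ltW q0)) := H.
have -> : 2 * h `^ s^-1 * (2^-1 * (sg `^ (1 - s^-1) * M `^ (s - 1))) =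
   sg `^ (1 - s^-1) * h `^ s^-1 * M `^ (s - 1) by field.
move=> /le_trans; apply; rewrite mulrDr addrC; apply: lerD.
  rewrite mulrCA mulVf ?gt_eqF// mulr1; apply: ler_wpM2r => //.
  by rewrite mulr_ge0// powR_ge0.
rewrite le_eqVlt; apply/orP; left; apply/eqP; rewrite qE; field.
by rewrite !gt_eqF.
Qed.

Section carleson.
Context d (T : measurableType d) (R : realType).
Variable mu : {measure set T -> \bar R}.

Lemma measurable_fun_powR (h : T -> R) r : measurable_fun [set: T] h ->
  measurable_fun [set: T] (fun x => h x `^ r).
Proof. by move=> mh; exact: (measurableT_comp (measurable_powR r)). Qed.

(** On [E Q] the average is at most the maximal function [M], and the sets [E Q] are disjoint, so
    the sum is at most the integral of sg M^s. This is controlled by [maximal_average_ineq] and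
    [young_absorb]. The a.e. bound on [g] expresses (g/sg)^s sg <= h without a division. *)
Lemma carleson_embedding (l : seq (set T)) (E : set T -> set T)
    (sg g h : T -> R) (s : R) :
  1 < s -> uniq l -> laminar l ->
  (forall Q, Q \in l -> measurable Q) ->
  (forall Q, measurable (E Q)) -> (forall Q, Q \in l -> E Q `<=` Q) ->
  trivIset [set` l] E ->
  measurable_fun [set: T] sg -> (forall x, 0 <= sg x) ->
  measurable_fun [set: T] g -> (forall x, 0 <= g x) ->
  measurable_fun [set: T] h -> (forall x, 0 <= h x) ->
  (\forall x \ae mu, g x <= sg x `^ (1 - s^-1) * h x `^ s^-1) ->
  (forall Q, Q \in l -> (0 < \int[mu]_(x in Q) (sg x)%:E < +oo)%E) ->
  (\int[mu]_x (h x)%:E < +oo)%E ->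
  (forall Q, Q \in l -> (\int[mu]_(x in Q) (g x)%:E < +oo)%E) /\
  \sum_(Q <- l) (fine (\int[mu]_(x in Q) (g x)%:E) /
                 fine (\int[mu]_(x in Q) (sg x)%:E)) `^ s *
                fine (\int[mu]_(x in E Q) (sg x)%:E) <=
  2 * 2 `^ s / (s - 1) * fine (\int[mu]_x (h x)%:E).
Proof.
move=> s1 ul laml ml mE EQ tE msg sg0 mg g0 mh h0 gsh fsg fh.
have mf (f : T -> R) D : measurable_fun [set: T] f ->
    measurable_fun D (fun x => (f x)%:E).
  by move=> ?; apply/measurable_funTS/measurable_EFinP.
have fg Q : Q \in l -> (\int[mu]_(x in Q) (g x)%:E < +oo)%E.
  move=> Ql.
  have mQ := ml _ Ql.
  apply: (@le_lt_trans _ _ (\int[mu]_(x in Q) (sg x + h x)%:E)%E).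
    apply: ae_ge0_le_integral => //.
    - by move=> x _; rewrite lee_fin.
    - exact: mf.
    - by move=> x _; rewrite lee_fin addr_ge0.
    - by apply: mf; exact: measurable_funD.
    - apply: filterS gsh => x gx _; rewrite lee_fin (le_trans gx)//.
      exact: young_product.
  under eq_integral do rewrite EFinD.
  rewrite ge0_integralD//; last 4 first.
  - by move=> x _; rewrite lee_fin.
  - exact: mf.
  - by move=> x _; rewrite lee_fin.
  - exact: mf.
  rewrite lte_add_pinfty//; first by have /andP[] := fsg _ Ql.
  apply: le_lt_trans fh; apply: ge0_subset_integral => //; first exact: mf.
  by move=> x _; rewrite lee_fin.
split => //.
pose lam Q := fine (\int[mu]_(x in Q) (g x)%:E) /
              fine (\int[mu]_(x in Q) (sg x)%:E).
have i0 (f : T -> R) D : (forall x, 0 <= f x) -> (0 <= \int[mu]_(x in D) (f x)%:E)%E.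
  by move=> f0; apply: integral_ge0 => x _; rewrite lee_fin.
have lam0 Q : 0 <= lam Q by rewrite divr_ge0// fine_ge0// i0.
have sfin Q : Q \in l -> (\int[mu]_(x in Q) (sg x)%:E)%E \is a fin_num.
  by move=> Ql; rewrite ge0_fin_numE ?i0//; have /andP[] := fsg _ Ql.
have gE Q : Q \in l -> (\int[mu]_(x in Q) (g x)%:E =
     (lam Q)%:E * \int[mu]_(x in Q) (sg x)%:E)%E.
  move=> Ql; rewrite -[in RHS](fineK (sfin _ Ql)) -EFinM /lam divfK.
    by rewrite fineK// ge0_fin_numE ?i0// fg.
  rewrite gt_eqF// fine_gt0// ltey_eq sfin// andbT.
  by have /andP[] := fsg _ Ql.
have [Xf Yf] := maximal_average_ineq s1 ul laml ml msg sg0 mg g0 lam0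
  (fun Q Ql => proj2 (andP (fsg Q Ql))) gE.
set M := maximal_average lam l in Xf Yf *.
have M0 x : 0 <= M x by exact: maximal_average_ge0.
have mM : measurable_fun [set: T] M by exact: measurable_maximal_average.
have mMp r : measurable_fun [set: T] (fun x => M x `^ r).
  exact: measurable_fun_powR.
have s10 : 0 < s - 1 by rewrite subr_gt0.
have s0 : 0 < s by rewrite (lt_trans _ s1).
set X := (\int[mu]_x (sg x * _)%:E)%E in Xf *.
set H := (\int[mu]_x (h x)%:E)%E.
set k := 2 `^ s / (s - 1).
have k0 : 0 <= k by rewrite divr_ge0 ?powR_ge0// ltW.
have X0 : (0 <= X)%E by apply: i0 => x; rewrite mulr_ge0// powR_ge0.
have H0 : (0 <= H)%E by exact: i0.
rewrite -ge0_integralZl_EFin//; last 3 first.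
- by move=> x _; rewrite lee_fin mulr_ge0// powR_ge0.
- by apply: mf; exact: measurable_funM.
- by rewrite divr_ge0// ltW.
have Yle : (\int[mu]_x ((s / (s - 1))%:E * (g x * M x `^ (s - 1))%:E) <=
    (2^-1)%:E * X + k%:E * H)%E.
  rewrite -ge0_integralZl_EFin//; last 2 first.
  - by move=> x _; rewrite lee_fin mulr_ge0// powR_ge0.
  - by apply: mf; exact: measurable_funM.
  rewrite -ge0_integralZl_EFin//; last 2 first.
  - by move=> x _; rewrite lee_fin.
  - exact: mf.
  have mX : measurable_fun [set: T] (fun x => 2^-1 * (sg x * M x `^ s)).
    by do 2 apply: measurable_funM => //.
  have mH : measurable_fun [set: T] (fun x => k * h x) by exact: measurable_funM.
  have X1 x : 0 <= 2^-1 * (sg x * M x `^ s) by rewrite !mulr_ge0// powR_ge0.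
  have H1 x : 0 <= k * h x by rewrite mulr_ge0.
  rewrite -ge0_integralD//; last 4 first.
  - by move=> x _; rewrite -EFinM lee_fin.
  - by under eq_fun do rewrite -EFinM; exact: mf.
  - by move=> x _; rewrite -EFinM lee_fin.
  - by under eq_fun do rewrite -EFinM; exact: mf.
  apply: ae_ge0_le_integral => //.
  - move=> x _; rewrite -EFinM lee_fin.
    by rewrite !mulr_ge0 ?powR_ge0 ?invr_ge0 ?(ltW s10) ?(ltW s0).
  - under eq_fun do rewrite -EFinM.
    by apply: mf; do 2 apply: measurable_funM => //.
  - by move=> x _; rewrite -!EFinM -EFinD lee_fin addr_ge0.
  - under eq_fun do rewrite -!EFinM -EFinD.
    by apply: mf; exact: measurable_funD.
  - apply: filterS gsh => x gx _; rewrite -!EFinM -EFinD lee_fin.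
    apply: le_trans (young_absorb s1 (sg0 x) (h0 x) (M0 x)).
    by rewrite ler_wpM2l ?divr_ge0 ?(ltW s10) ?(ltW s0)// ler_wpM2r ?powR_ge0.
move=> /le_trans /(_ Yle).
have Xfin : X \is a fin_num by rewrite ge0_fin_numE.
have Hfin : H \is a fin_num by rewrite ge0_fin_numE.
rewrite -(fineK Xfin) -(fineK Hfin) -!EFinM -EFinD lee_fin => Xle.
(* Half of [X] is absorbed into the left side, which is legitimate because [X] is finite. *)
have {}Xle : fine X <= 2 * 2 `^ s / (s - 1) * fine H.
  by rewrite -[2 * 2 `^ s / _]mulrA -/k; lra.
apply: le_trans Xle; rewrite -lee_fin (fineK Xfin).
have mX : measurable_fun [set: T] (fun x => sg x * M x `^ s).
  exact: measurable_funM.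
have X1 x : 0 <= sg x * M x `^ s by rewrite mulr_ge0// powR_ge0.
apply: (@le_trans _ _ (\int[mu]_(x in \big[setU/set0]_(Q <- l) E Q)
    (sg x * M x `^ s)%:E)%E); last first.
  apply: ge0_subset_integral => //; first exact: bigsetU_measurable.
    exact: mf.
  by move=> x _; rewrite lee_fin.
rewrite ge0_integral_bigsetU//; last 2 first.
  exact: mf.
  by move=> x _; rewrite lee_fin.
rewrite -sumEFin big_seq [leRHS]big_seq; apply: lee_sum => Q Ql.
have sEle : (\int[mu]_(x in E Q) (sg x)%:E <= \int[mu]_(x in Q) (sg x)%:E)%E.
  apply: ge0_subset_integral => //; [exact: ml|exact: mf| |exact: EQ].
  by move=> x _; rewrite lee_fin.
rewrite EFinM fineK; last first.
  rewrite ge0_fin_numE ?i0// (le_lt_trans sEle)//.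
  by have /andP[] := fsg _ Ql.
rewrite -ge0_integralZl_EFin ?powR_ge0//; last 2 first.
  by move=> x _; rewrite lee_fin.
  exact: mf.
apply: ge0_le_integral => //.
- by move=> x _; rewrite -EFinM lee_fin mulr_ge0 ?powR_ge0.
- under eq_fun do rewrite -EFinM.
  by apply: mf; exact: measurable_funM.
- exact: mf.
- move=> x Ex; rewrite -EFinM lee_fin mulrC ler_wpM2l//.
  apply: ge0_ler_powR; rewrite ?nnegrE ?(ltW s0)// ?M0 ?lam0//.
  apply: le_maximal_average => //; apply/mem_set; exact: EQ Ex.
Qed.

End carleson.

(** * Integrals over a set of positive measure *)

Section holder.
Context d (T : measurableType d) (R : realType).
Variable mu : {measure set T -> \bar R}.

(** A zero integral would force [u] to vanish a.e. on [A], and then [A] would be null. *)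
Lemma integral_gt0_ae (A : set T) (u : T -> R) : measurable A ->
  (0 < mu A)%E -> measurable_fun [set: T] u -> (forall x, 0 <= u x) ->
  (\forall x \ae mu, 0 < u x) -> (0 < \int[mu]_(x in A) (u x)%:E)%E.
Proof.
move=> mA A0 mf u0 up; rewrite lt0e integral_ge0 => [|x _]; last by rewrite lee_fin.
rewrite andbT; apply/eqP => I0.
have : (\int[mu]_(x in A) `|(u x)%:E|)%E = 0%E.
  by rewrite -[RHS]I0; apply: eq_integral => x _; rewrite gee0_abs// lee_fin.
move/ae_eq_integral_abs => /(_ mA).
have mu' : measurable_fun A (fun x => (u x)%:E).
  by apply/measurable_funTS/measurable_EFinP.
move=> /(_ mu') uz.
have : mu.-negligible A.
  rewrite -[A]setCK; apply: filterS2 up uz => x ux /= uAx Ax.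
  by have [] := uAx Ax; apply/eqP; rewrite gt_eqF.
by move=> /measure_negligible => /(_ mA) A00; move: A0; rewrite A00 ltxx.
Qed.

(** Hoelder's inequality for several functions whose product dominates 1, again by normalising each
    function by its integral and using [weighted_amgm] pointwise. *)
Lemma measure_le_holder (I : finType) (A : set T) (v : T -> R) (u : I -> T -> R)
    (t0 : R) (t : I -> R) : measurable A ->
  measurable_fun [set: T] v -> (forall x, 0 <= v x) ->
  (forall i, measurable_fun [set: T] (u i)) -> (forall i x, 0 <= u i x) ->
  (0 < \int[mu]_(x in A) (v x)%:E < +oo)%E ->
  (forall i, 0 < \int[mu]_(x in A) (u i x)%:E < +oo)%E ->
  0 <= t0 -> (forall i, 0 <= t i) -> t0 + \sum_i t i = 1 ->
  (\forall x \ae mu, 1 <= v x `^ t0 * \prod_i u i x `^ t i) ->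
  (mu A <= (fine (\int[mu]_(x in A) (v x)%:E) `^ t0 *
     \prod_i fine (\int[mu]_(x in A) (u i x)%:E) `^ t i)%:E)%E.
Proof.
move=> mA mv v0 mu' u0 Iv Iu t00 ti0 t1 le1.
have mf (f : T -> R) : measurable_fun [set: T] f ->
    measurable_fun A (fun x => (f x)%:E).
  by move=> ?; apply/measurable_funTS/measurable_EFinP.
set V := fine (\int[mu]_(x in A) (v x)%:E).
pose U i := fine (\int[mu]_(x in A) (u i x)%:E); rewrite -/(U _).
have V0 : 0 < V by rewrite fine_gt0.
have U0 i : 0 < U i by rewrite fine_gt0.
move kE : (V `^ t0 * \prod_i U i `^ t i) => k.
have k0 : 0 <= k by rewrite -kE mulr_ge0 ?powR_ge0// prodr_ge0// => i _; exact: powR_ge0.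
(* The arithmetic mean, scaled by [k]. It dominates 1 a.e., and its integral over [A] is [k] since
   the exponents sum to 1. *)
pose F x := k * (t0 / V) * v x + \sum_i k * (t i / U i) * u i x.
have s0 x : 0 <= \sum_i k * (t i / U i) * u i x.
  by apply: sumr_ge0 => i _; rewrite !mulr_ge0// ?invr_ge0 ?ltW.
have F0 x : 0 <= F x by rewrite addr_ge0// !mulr_ge0// ?invr_ge0 ?ltW.
have ms : measurable_fun [set: T] (fun x => \sum_i k * (t i / U i) * u i x).
  by apply: measurable_sum => i; exact: measurable_funM.
have mF : measurable_fun [set: T] F.
  by apply: measurable_funD => //; exact: measurable_funM.
apply: (@le_trans _ _ (\int[mu]_(x in A) (F x)%:E)%E).
  rewrite -[leLHS]mul1e -integral_cst//; apply: ae_ge0_le_integral => //.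
  - by move=> x _; rewrite lee_fin.
  - exact: mf.
  - apply: filterS le1 => x le1x _; rewrite lee_fin (le_trans le1x)//.
    have -> : v x `^ t0 * \prod_i u i x `^ t i =
        k * ((v x / V) `^ t0 * \prod_i (u i x / U i) `^ t i).
      rewrite -kE mulrACA -powRM ?divr_ge0// ?(ltW V0)// [V * _]mulrC divfK ?gt_eqF//.
      rewrite -big_split/=; congr (_ * _); apply: eq_bigr => i _.
      by rewrite -powRM ?divr_ge0// ?(ltW (U0 i))// [U i * _]mulrC divfK// gt_eqF.
    have -> : F x = k * (t0 * (v x / V) + \sum_i t i * (u i x / U i)).
      rewrite mulrDr mulr_sumr /F; congr (_ + _); first by ring.
      by apply: eq_bigr => i _; ring.
    apply: ler_wpM2l => //; apply: weighted_amgm => //.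
      by rewrite divr_ge0// ltW.
    by move=> i; rewrite divr_ge0// ltW.
under eq_integral do rewrite EFinD -sumEFin EFinM.
rewrite ge0_integralD//; last 4 first.
- by move=> x _; rewrite -EFinM lee_fin !mulr_ge0// ?invr_ge0 ?ltW.
- by under eq_fun do rewrite -EFinM; apply: mf; exact: measurable_funM.
- by move=> x _; rewrite sumEFin lee_fin.
- by under eq_fun do rewrite sumEFin; exact: mf.
rewrite ge0_integralZl_EFin//; last 3 first.
- by move=> x _; rewrite lee_fin.
- exact: mf.
- by rewrite !mulr_ge0// ?invr_ge0 ?ltW.
rewrite ge0_integral_sum//; last 2 first.
- by move=> i; apply: mf; exact: measurable_funM.
- by move=> i x _; rewrite lee_fin !mulr_ge0// ?invr_ge0 ?ltW.
rewrite -[X in (_ * X)%E]fineK; last by have /andP[+ +] := Iv; case: (integral _ _ _).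
have -> : (\sum_i \int[mu]_(x in A) (k * (t i / U i) * u i x)%:E =
    (\sum_i k * t i)%:E)%E.
  rewrite -sumEFin; apply: eq_bigr => i _; under eq_integral do rewrite EFinM.
  rewrite ge0_integralZl_EFin//; last 3 first.
  - by move=> x _; rewrite lee_fin.
  - exact: mf.
  - by rewrite !mulr_ge0// ?invr_ge0 ?ltW.
  rewrite -[X in (_ * X)%E]fineK; last first.
    by have /andP[+ +] := Iu i; case: (integral _ _ _).
  by rewrite -EFinM -/(U i) -!mulrA mulVf ?mulr1// gt_eqF.
by rewrite -EFinM -EFinD lee_fin -/V -!mulrA mulVf ?gt_eqF// mulr1 -mulr_sumr -mulrDr t1 mulr1.
Qed.

End holder.

(** * Weights on a sparse cube *)

Lemma inv_conj_exp (R : realType) (p0 q : R) : 0 < p0 -> p0 < q ->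
  (conj_exp (q / p0))^-1 = 1 - p0 / q.
Proof.
move=> p00 p0q; have q0 := lt_trans p00 p0q.
rewrite /conj_exp; field.
by rewrite !gt_eqF// mulN1r subr_gt0.
Qed.

Lemma conj_exp_gt1 (R : realType) (p0 q : R) : 0 < p0 -> p0 < q ->
  1 < conj_exp (q / p0).
Proof.
move=> p00 p0q; have r1 : 0 < q / p0 - 1.
  by rewrite subr_gt0 ltr_pdivlMr// mul1r.
by rewrite /conj_exp ltr_pdivlMr// mul1r gtrBl.
Qed.

Section weights.
Context d (T : measurableType d) (R : realType).
Variables (mu : {measure set T -> \bar R}) (m : nat) (p0 p : R) (P : 'I_m -> R).
Hypotheses (m_gt0 : (0 < m)%N) (p0_ge1 : 1 <= p0).
Hypotheses (p0P : forall i, p0 < P i) (sumP : \sum_(i < m) (P i)^-1 = p^-1).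
Variable w : 'I_m -> T -> R.
Hypotheses (mw : forall i, measurable_fun [set: T] (w i))
           (w_ge0 : forall i x, 0 <= w i x)
           (w_gt0 : forall i, \forall x \ae mu, 0 < w i x).

Local Notation cj i := (conj_exp (P i / p0)).

(** The weight sigma_i of the overview and, next to it, nu, over an arbitrary measure space; on R^n
    they unfold to the functions inside [A_const]. *)
Definition dual_weight i x := w i x `^ (1 - cj i).
Definition product_weight x := \prod_(i < m) w i x `^ (p / P i).
Local Notation nuw := product_weight.
Local Notation sg := dual_weight.

Lemma p0_gt0 : 0 < p0. Proof. exact: lt_le_trans p0_ge1. Qed.

Lemma P_gt0 i : 0 < P i. Proof. by rewrite (lt_trans p0_gt0). Qed.

Lemma p_gt0 : 0 < p.
Proof.
rewrite -invr_gt0 -sumP (bigD1 (Ordinal m_gt0))//= ltr_pwDl ?invr_gt0 ?P_gt0//.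
by apply: sumr_ge0 => i _; rewrite invr_ge0 ltW// P_gt0.
Qed.

Lemma measurable_dual_weight i : measurable_fun [set: T] (sg i).
Proof. exact: measurable_fun_powR. Qed.

Lemma measurable_product_weight : measurable_fun [set: T] nuw.
Proof. by apply: measurable_prod => i _; exact: measurable_fun_powR. Qed.

Lemma dual_weight_ge0 i x : 0 <= sg i x. Proof. exact: powR_ge0. Qed.

Lemma product_weight_ge0 x : 0 <= nuw x.
Proof. by apply: prodr_ge0 => i _; exact: powR_ge0. Qed.

Lemma weights_gt0 : \forall x \ae mu, forall i, 0 < w i x.
Proof. exact: filter_forall. Qed.

Lemma dual_weight_gt0 i : \forall x \ae mu, 0 < sg i x.
Proof. by apply: filterS (w_gt0 i) => x wx; exact: powR_gt0. Qed.

Lemma product_weight_gt0 : \forall x \ae mu, 0 < nuw x.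
Proof.
by apply: filterS weights_gt0 => x wx; apply: prodr_gt0 => i _; exact: powR_gt0.
Qed.

(** So p0/p and the inverses of the conjugate exponents add up to [m]; divided by [m] they become
    Hoelder exponents. *)
Lemma sum_inv_conj : \sum_(i < m) (cj i)^-1 = m%:R - p0 / p.
Proof.
under eq_bigr => i _ do rewrite inv_conj_exp ?p0_gt0//.
by rewrite sumrB sumr_const card_ord -mulr_sumr sumP.
Qed.

(** Up to the common factor 1/m, [w i] has exponent p0/P_i from nu and (1 - r')/r' = -p0/P_i from
    sigma_i, where r' is conjugate to P_i/p0. *)
Lemma dual_weight_product x : (forall i, 0 < w i x) ->
  nuw x `^ (p0 / p / m%:R) * \prod_(i < m) sg i x `^ ((cj i)^-1 / m%:R) = 1.
Proof.
move=> wx; rewrite prodr_powR => [|i]; last exact: powR_ge0.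
rewrite -big_split big1//= => i _; rewrite -!powRrM -powRD; last first.
  by rewrite (gt_eqF (wx i)) implybT.
rewrite [X in _ `^ X](_ : _ = 0) ?powRr0//.
have mN0 : m%:R != 0 :> R by rewrite pnatr_eq0 -lt0n.
have cjN0 : cj i != 0 by rewrite gt_eqF// (lt_trans _ (conj_exp_gt1 p0_gt0 (p0P i))).
rewrite [(1 - _) * _]mulrA mulrBl mul1r divff// inv_conj_exp ?p0_gt0//.
by field; rewrite mN0 !gt_eqF ?P_gt0 ?p_gt0.
Qed.

Section cube.
Variables (Q A : set T).
Hypotheses (mQ : measurable Q) (mA : measurable A) (AQ : A `<=` Q).
Hypotheses (Q_gt0 : (0 < mu Q < +oo)%E) (QA : (mu Q <= 2%:E * mu A)%E).
Hypotheses (nu_fin : (\int[mu]_(x in Q) (nuw x)%:E < +oo)%E)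
           (sg_fin : forall i, (\int[mu]_(x in Q) (sg i x)%:E < +oo)%E).

Lemma mu_sparse_gt0 : (0 < mu A)%E.
Proof.
have /andP[Q0 _] := Q_gt0; have := lt_le_trans Q0 QA.
by rewrite (lt0e (mu A)) measure_ge0 andbT; apply: contraTneq => ->; rewrite mule0 ltxx.
Qed.

Lemma integral_subcube_gt0 (u : T -> R) : measurable_fun [set: T] u ->
  (forall x, 0 <= u x) -> (\forall x \ae mu, 0 < u x) ->
  (\int[mu]_(x in Q) (u x)%:E < +oo)%E ->
  (0 < \int[mu]_(x in A) (u x)%:E < +oo)%E /\
  (\int[mu]_(x in A) (u x)%:E <= \int[mu]_(x in Q) (u x)%:E)%E.
Proof.
move=> mu' u0 up uf.
have le : (\int[mu]_(x in A) (u x)%:E <= \int[mu]_(x in Q) (u x)%:E)%E.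
  apply: ge0_subset_integral => //; last by move=> x _; rewrite lee_fin.
  exact/measurable_funTS/measurable_EFinP.
rewrite le (le_lt_trans le uf) andbT; split => //.
by apply: integral_gt0_ae => //; exact: mu_sparse_gt0.
Qed.

Local Notation V := (fine (mu Q)).
Local Notation N B := (fine (\int[mu]_(x in B) (nuw x)%:E)).
Local Notation S i B := (fine (\int[mu]_(x in B) (sg i x)%:E)).

(** [measure_le_holder] on [A] and sparseness bound 1/2 by a product of powers of the averages.
    Raising it to the power m p/p0 turns the exponents into those of the weight constant. *)
Lemma A_const_subcube_ge :
  2^-1 `^ (m%:R * p / p0) <=
  N A / V * \prod_(i < m) (S i A / V) `^ (p / p0 / cj i).
Proof.
have m0 : 0 < m%:R :> R by rewrite ltr0n.
have cj0 i : 0 < cj i by rewrite (lt_trans _ (conj_exp_gt1 p0_gt0 (p0P i))).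
have [nuA _] := integral_subcube_gt0 measurable_product_weight
  product_weight_ge0 product_weight_gt0 nu_fin.
have sgA i := (integral_subcube_gt0 (measurable_dual_weight i)
  (dual_weight_ge0 i) (dual_weight_gt0 i) (sg_fin i)).1.
have t1 : p0 / p / m%:R + \sum_(i < m) (cj i)^-1 / m%:R = 1.
  by rewrite -mulr_suml sum_inv_conj -mulrDl subrKC divff// gt_eqF.
have := @measure_le_holder _ _ _ mu 'I_m A nuw sg (p0 / p / m%:R)
  (fun i => (cj i)^-1 / m%:R) mA measurable_product_weight product_weight_ge0
  measurable_dual_weight dual_weight_ge0 nuA sgA.
have t00 : 0 <= p0 / p / m%:R by rewrite !divr_ge0 ?(ltW p_gt0) ?(ltW p0_gt0).
have ti0 i : 0 <= (cj i)^-1 / m%:R by rewrite divr_ge0 ?invr_ge0 ?(ltW (cj0 i)).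
move=> /(_ t00 ti0 t1); set h := (X in X%:E) => H.
have {}H : (mu A <= h%:E)%E.
  by apply: H; apply: filterS weights_gt0 => x wx; rewrite dual_weight_product.
have V0 : 0 < V by rewrite fine_gt0.
have N0 : 0 <= N A by rewrite ltW// fine_gt0.
have S0 i : 0 <= S i A by rewrite ltW// fine_gt0.
have Vh : V <= 2 * h.
  rewrite -lee_fin fineK; last by have /andP[? ?] := Q_gt0; rewrite ge0_fin_numE.
  by rewrite (le_trans QA)// EFinM lee_wpmul2l.
have {Vh H} : 2^-1 <= (N A / V) `^ (p0 / p / m%:R) *
    \prod_(i < m) (S i A / V) `^ ((cj i)^-1 / m%:R).
  have -> : (N A / V) `^ (p0 / p / m%:R) *
    \prod_(i < m) (S i A / V) `^ ((cj i)^-1 / m%:R) = h / V.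
    rewrite powRM ?invr_ge0 ?(ltW V0)//.
    under eq_bigr => i _ do rewrite powRM ?invr_ge0 ?(ltW V0)//.
    rewrite big_split/= mulrACA -powR_sum ?invr_gt0//.
    by rewrite -powRD ?t1 ?powRr1 ?invr_ge0 ?(ltW V0)// invr_eq0 (gt_eqF V0) implybT.
  by rewrite ler_pdivlMr// mulrC ler_pdivrMr// mulrC.
set u := _ * _ => H.
have -> : N A / V * \prod_(i < m) (S i A / V) `^ (p / p0 / cj i) =
    u `^ (m%:R * p / p0).
  rewrite powRM ?powR_ge0 ?prodr_ge0//; last by move=> i _; exact: powR_ge0.
  rewrite prodr_powR => [|i]; last exact: powR_ge0.
  rewrite -powRrM [X in _ = _ `^ X * _](_ : _ = 1); last first.
    by field; rewrite !gt_eqF ?p_gt0 ?p0_gt0.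
  rewrite powRr1 ?divr_ge0 ?(ltW V0)//; congr (_ * _); apply: eq_bigr => i _.
  rewrite -powRrM; congr (_ `^ _); field.
  by rewrite !gt_eqF ?p_gt0 ?p0_gt0.
apply: ge0_ler_powR => //.
- by rewrite divr_ge0 ?mulr_ge0 ?ler0n ?(ltW p_gt0) ?(ltW p0_gt0).
- by rewrite nnegrE invr_ge0.
- by rewrite nnegrE (le_trans _ H)// invr_ge0.
Qed.

(** [weight_exponents] for the averages over [Q] and [A], with [B = b * t], [a = t / p], and [L] the
    bound of [A_const_subcube_ge]. The condition e_i <= B c_i amounts to [cj i <= b * p], which is
    where the exponent of the theorem comes from. *)
Lemma weight_cube_le (K b t : R) :
  N Q / V * \prod_(i < m) (S i Q / V) `^ (p / p0 / cj i) <= K ->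
  1 <= b -> (forall i, cj i / p <= b) -> t = Num.min 1 p ->
  N Q * \prod_(i < m) (S i Q / V) `^ (t / p0) <=
  (2^-1 `^ (m%:R * p / p0)) `^ (t / p - b * t) * K `^ (b * t) *
  (N A `^ (1 - t / p) * \prod_(i < m) S i A `^ (t / P i)).
Proof.
move=> AK b1 bcj tE.
have p_0 := p_gt0; have p0_0 := p0_gt0.
have cj1 i := conj_exp_gt1 p0_0 (p0P i).
have cj0 i : 0 < cj i by rewrite (lt_trans _ (cj1 i)).
have t0 : 0 < t by rewrite tE lt_min ltr01.
have bp i : cj i <= b * p by rewrite -ler_pdivrMr.
(* For p < 1 one has t = p, and b p is at least a conjugate exponent, which exceeds 1; such an index
   exists since [m] is positive. *)
have bt1 : 1 <= b * t.
  have i := Ordinal m_gt0; rewrite tE minEle; case: ifP => _; first by rewrite mulr1.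
  by rewrite (le_trans _ (bp i))// ltW.
have b0 : 0 < b by rewrite (lt_le_trans _ b1).
have V0 : 0 < V by rewrite fine_gt0.
have [nuA nuAQ] := integral_subcube_gt0 measurable_product_weight
  product_weight_ge0 product_weight_gt0 nu_fin.
have sgA i := integral_subcube_gt0 (measurable_dual_weight i)
  (dual_weight_ge0 i) (dual_weight_gt0 i) (sg_fin i).
have fle (x y : \bar R) : (0 < x < +oo)%E -> (x <= y)%E -> (y < +oo)%E ->
    fine x / V <= fine y / V.
  move=> /andP[x0 xy] le yy; rewrite ler_pM2r ?invr_gt0// fine_le//.
    by rewrite ge0_fin_numE// ltW.
  by rewrite ge0_fin_numE// (le_trans _ le)// ltW.
have := @weight_exponents R 'I_m (N Q / V) (N A / V) K (2^-1 `^ (m%:R * p / p0))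
  (b * t) (t / p) (fun i => S i Q / V) (fun i => S i A / V)
  (fun i => p / p0 / cj i) (fun=> t / p0) (fun i => t / P i).
rewrite divr_gt0 ?fine_gt0// => /(_ isT (fle _ _ nuA nuAQ nu_fin)).
move=> /(_ _ (fun i => fle _ _ (sgA i).1 (sgA i).2 (sg_fin i))).
have SV0 i : 0 < S i A / V by rewrite divr_gt0// fine_gt0//; have [] := sgA i.
move=> /(_ SV0); rewrite powR_gt0// => /(_ isT AK A_const_subcube_ge bt1).
have i := Ordinal m_gt0.
have abt : t / p <= b * t.
  rewrite mulrC ler_pM2r// (le_trans _ (bcj i))// ler_pdivlMr// mulVf ?gt_eqF//.
  exact: ltW.
have e1 j : t / p0 <= b * t * (p / p0 / cj j).
  have -> : b * t * (p / p0 / cj j) = t / p0 * (b * p / cj j) by ring.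
  by rewrite ler_peMr ?divr_ge0 ?(ltW t0) ?(ltW p0_0)// ler_pdivlMr// mul1r.
have e2 j : t / p0 - t / P j = t / p * (p / p0 / cj j).
  rewrite inv_conj_exp//; field.
  by rewrite !gt_eqF// P_gt0.
move=> /(_ abt e1 e2); rewrite mulrAC ler_pdivrMr// => /le_trans; apply.
rewrite -!mulrA ler_wpM2l ?powR_ge0// ler_wpM2l ?powR_ge0//.
have NA0 : 0 <= N A by rewrite ltW// fine_gt0.
have SA0 j : 0 <= S j A by rewrite ltW// fine_gt0//; have [] := sgA j.
(* The powers of 1/V have total exponent (1 - t/p) + t/p = 1 and cancel the factor [V]. *)
rewrite powRM ?invr_ge0 ?(ltW V0)//.
under eq_bigr => j _ do rewrite powRM ?invr_ge0 ?(ltW V0)//.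
rewrite big_split/= -powR_sum ?invr_gt0// -mulr_sumr sumP.
rewrite [X in X <= _](_ : _ = N A `^ (1 - t / p) *
    \prod_(i < m) S i A `^ (t / P i) *
    (V^-1 `^ (1 - t / p) * V^-1 `^ (t / p)) * V); last by ring.
rewrite -powRD ?invr_eq0 ?(gt_eqF V0) ?implybT// subrK powRr1 ?invr_ge0 ?(ltW V0)//.
by rewrite divfK ?gt_eqF.
Qed.

End cube.

(** * Finite sparse families *)

Section finite_family.
Variables (l : seq (set T)) (E : set T -> set T).
Hypotheses (ul : uniq l) (laml : laminar l)
  (ml : forall Q, Q \in l -> measurable Q)
  (mul : forall Q, Q \in l -> (0 < mu Q < +oo)%E)
  (mE : forall Q, measurable (E Q)) (EQ : forall Q, Q \in l -> E Q `<=` Q)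
  (tE : trivIset [set` l] E)
  (sparseE : forall Q, Q \in l -> (mu Q <= 2%:E * mu (E Q))%E)
  (nu_fin : forall Q, Q \in l -> (\int[mu]_(x in Q) (nuw x)%:E < +oo)%E)
  (sg_fin : forall Q i, Q \in l -> (\int[mu]_(x in Q) (sg i x)%:E < +oo)%E).

Let mf (u : T -> R) D : measurable_fun [set: T] u ->
  measurable_fun D (fun x => (u x)%:E).
Proof. by move=> ?; apply/measurable_funTS/measurable_EFinP. Qed.

Let i0 (u : T -> R) D : (forall x, 0 <= u x) ->
  (0 <= \int[mu]_(x in D) (u x)%:E)%E.
Proof. by move=> u0; apply: integral_ge0 => x _; rewrite lee_fin. Qed.

Lemma cube_integral_gt0 (u : T -> R) Q : Q \in l -> measurable_fun [set: T] u ->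
  (forall x, 0 <= u x) -> (\forall x \ae mu, 0 < u x) ->
  (\int[mu]_(x in Q) (u x)%:E < +oo)%E ->
  (0 < \int[mu]_(x in Q) (u x)%:E < +oo)%E.
Proof.
move=> Ql mu' u0 up ->; rewrite andbT; apply: integral_gt0_ae => //; first exact: ml.
by have /andP[] := mul Ql.
Qed.

Section function_norms.
Variables (i : 'I_m) (f : T -> R).
Hypotheses (mfun : measurable_fun [set: T] f)
  (f_fin : (\int[mu]_x (`|f x| `^ P i * w i x)%:E < +oo)%E).

Definition carleson_const (s : R) : R := 2 * 2 `^ s / (s - 1).

(** The embedding for sigma_i with s = P_i/p0, g = |f|^p0 and h = |f|^(P_i) w_i. In the required
    factorisation of [g] the powers of w_i cancel, since (1 - r')(1 - 1/s) = -1/s for r' conjugate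
    to s. *)
Lemma carleson_dual_weight :
  (forall Q, Q \in l -> (\int[mu]_(x in Q) (`|f x| `^ p0)%:E < +oo)%E) /\
  \sum_(Q <- l) (fine (\int[mu]_(x in Q) (`|f x| `^ p0)%:E) /
                 fine (\int[mu]_(x in Q) (sg i x)%:E)) `^ (P i / p0) *
                fine (\int[mu]_(x in E Q) (sg i x)%:E) <=
  carleson_const (P i / p0) * fine (\int[mu]_x (`|f x| `^ P i * w i x)%:E).
Proof.
have p0_0 := p0_gt0; have P0 := P_gt0 i.
have mnf r : measurable_fun [set: T] (fun x => `|f x| `^ r).
  by apply: measurable_fun_powR; exact: measurableT_comp.
apply: carleson_embedding => //.
- by rewrite ltr_pdivlMr// mul1r.
- exact: measurable_dual_weight.
- exact: dual_weight_ge0.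
- exact: measurable_funM.
- by move=> x; rewrite mulr_ge0// powR_ge0.
- apply: filterS (w_gt0 i) => x wx; rewrite /dual_weight.
  rewrite powRM ?powR_ge0// -!powRrM mulrCA -powRD; last first.
    by rewrite (gt_eqF wx) implybT.
  have -> : P i * (P i / p0)^-1 = p0 by field; rewrite !gt_eqF.
  rewrite [X in w i x `^ X](_ : _ = 0) ?powRr0 ?mulr1//.
  rewrite /conj_exp; field; rewrite !gt_eqF//.
  by rewrite mulN1r subr_gt0.
- move=> Q Ql; apply: cube_integral_gt0 => //; last exact: sg_fin.
  + exact: measurable_dual_weight.
  + exact: dual_weight_ge0.
  + exact: dual_weight_gt0.
Qed.

End function_norms.

Variable f : 'I_m -> T -> R.
Hypotheses (mfun : forall i, measurable_fun [set: T] (f i))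
  (f_fin : forall i, (\int[mu]_x (`|f i x| `^ P i * w i x)%:E < +oo)%E).

Local Notation V Q := (fine (mu Q)).
Local Notation N B := (fine (\int[mu]_(x in B) (nuw x)%:E)).
Local Notation S i B := (fine (\int[mu]_(x in B) (sg i x)%:E)).
Local Notation G i Q := (fine (\int[mu]_(x in Q) (`|f i x| `^ p0)%:E)).
Local Notation H i := (fine (\int[mu]_x (`|f i x| `^ P i * w i x)%:E)).

(** The real form of the product of the [paverage p0 Q (f i)]; the two agree once the local
    integrals are finite. *)
Definition sparse_coef Q := \prod_(i < m) ((V Q)^-1 * G i Q) `^ p0^-1.
Local Notation a := sparse_coef.

Definition sparse_sum x := \sum_(Q <- l) a Q * \1_Q x.
Local Notation F := sparse_sum.

Lemma sparse_coef_ge0 Q : 0 <= a Q.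
Proof. by apply: prodr_ge0 => i _; exact: powR_ge0. Qed.

Lemma sparse_sum_ge0 x : 0 <= F x.
Proof. by apply: sumr_ge0 => Q _; rewrite mulr_ge0 ?sparse_coef_ge0. Qed.

Lemma sparse_sum_le x : F x <= \sum_(Q <- l) a Q.
Proof.
by apply: ler_sum => Q _; rewrite ler_piMr ?sparse_coef_ge0.
Qed.

Lemma measurable_sparse_sum : measurable_fun [set: T] F.
Proof.
have -> : F = (fun x => \sum_(Q <- l) (if Q \in l then a Q * \1_Q x else 0)).
  by apply/funext => x; apply: eq_big_seq => Q Ql; rewrite ifT.
apply: measurable_sum => Q; case: (boolP (Q \in l)) => // Ql.
by apply: measurable_funM => //; apply: measurable_indic; exact: ml.
Qed.

Local Notation t := (Num.min 1 p).

Let t_gt0 : 0 < t. Proof. by rewrite lt_min ltr01 p_gt0. Qed.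
Let t_le1 : t <= 1. Proof. by rewrite ge_min lexx. Qed.
Let t_lep : t <= p. Proof. by rewrite ge_min lexx orbT. Qed.

Let mFp r : measurable_fun [set: T] (fun x => F x `^ r * nuw x).
Proof.
apply: measurable_funM; last exact: measurable_product_weight.
exact/measurable_fun_powR/measurable_sparse_sum.
Qed.

Let Fp0 r x : 0 <= F x `^ r * nuw x.
Proof. by rewrite mulr_ge0 ?powR_ge0 ?product_weight_ge0. Qed.

(** A finite sum of multiples of indicators is bounded and p - t >= 0, so the finiteness of nu(Q)
    suffices. *)
Lemma sparse_sum_cube_fin Q : Q \in l ->
  (\int[mu]_(x in Q) (F x `^ (p - t) * nuw x)%:E < +oo)%E.
Proof.
move=> Ql; set A := (\sum_(Q <- l) a Q) `^ (p - t).
apply: (@le_lt_trans _ _ (\int[mu]_(x in Q) (A%:E * (nuw x)%:E))%E).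
  apply: ge0_le_integral => //.
  - exact: ml.
  - by move=> x _; rewrite lee_fin.
  - exact: mf.
  - under eq_fun do rewrite -EFinM.
    by apply: mf; apply: measurable_funM => //; exact: measurable_product_weight.
  - move=> x _; rewrite -EFinM lee_fin ler_wpM2r ?product_weight_ge0//.
    apply: ge0_ler_powR; rewrite ?subr_ge0 ?nnegrE ?sparse_sum_ge0 ?sparse_sum_le//.
    by apply: sumr_ge0 => B _; exact: sparse_coef_ge0.
rewrite ge0_integralZl_EFin ?powR_ge0//; last 3 first.
- exact: ml.
- by move=> x _; rewrite lee_fin product_weight_ge0.
- exact/mf/measurable_product_weight.
have := nu_fin Ql; have := @i0 _ Q product_weight_ge0.
by case: (integral _ _ _) => //= r _ _; rewrite -EFinM ltry.
Qed.

Lemma sparse_sum_linearize :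
  (\int[mu]_x (F x `^ p * nuw x)%:E <=
   (\sum_(Q <- l) a Q `^ t *
      fine (\int[mu]_(x in Q) (F x `^ (p - t) * nuw x)%:E))%:E)%E.
Proof.
pose k Q x := (((fun x => (F x `^ (p - t) * nuw x)%:E) \_ Q) x)%E.
have k0 Q x : (0 <= k Q x)%E.
  by rewrite /k patchE; case: ifP => //; rewrite lee_fin.
have mk Q : Q \in l -> measurable_fun [set: T] (k Q).
  move=> Ql; apply/(measurable_restrictT _ (ml Ql)); exact: mf.
(* The test [Q \in l] makes every summand measurable, as only the members of [l] are known to be
   measurable sets. *)
have -> : ((\sum_(Q <- l) a Q `^ t *
      fine (\int[mu]_(x in Q) (F x `^ (p - t) * nuw x)%:E))%:E =
    \int[mu]_x (\sum_(Q <- l) (a Q `^ t)%:E * (if Q \in l then k Q x else 0)))%E.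
  rewrite ge0_integral_sum//; last 2 first.
  - move=> Q; case: (boolP (Q \in l)) => // Ql.
    by apply: emeasurable_funM => //; exact: mk.
  - by move=> Q x _; rewrite mule_ge0 ?lee_fin ?powR_ge0//; case: ifP.
  rewrite -sumEFin big_seq [RHS]big_seq; apply: eq_bigr => Q Ql.
  rewrite Ql ge0_integralZl_EFin ?powR_ge0//; last exact: mk.
  rewrite -integral_mkcond EFinM fineK// ge0_fin_numE ?sparse_sum_cube_fin//.
  exact: i0.
apply: ge0_le_integral => //.
- by move=> x _; rewrite lee_fin.
- exact: mf.
- apply: emeasurable_sum => Q; case: (boolP (Q \in l)) => // Ql.
  by apply: emeasurable_funM => //; exact: mk.
move=> x _.
have -> : (\sum_(Q <- l) (a Q `^ t)%:E * (if Q \in l then k Q x else 0) =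
    (\sum_(Q <- l) (a Q * \1_Q x) `^ t * (F x `^ (p - t) * nuw x))%:E)%E.
  rewrite -sumEFin big_seq [RHS]big_seq; apply: eq_bigr => Q Ql.
  rewrite Ql /k patchE indicE; case: ifP => xQ; first by rewrite mulr1.
  by rewrite mulr0 powR0 ?mul0r ?mule0// gt_eqF.
rewrite lee_fin -mulr_suml mulrA ler_wpM2r ?product_weight_ge0//.
have -> : F x `^ p = F x `^ t * F x `^ (p - t).
  by rewrite -powRD addrC subrK// (gt_eqF p_gt0).
apply: ler_wpM2r; first exact: powR_ge0.
apply: powR_sum_le; first by rewrite t_gt0 t_le1.
by move=> Q; rewrite mulr_ge0 ?sparse_coef_ge0.
Qed.

Lemma sparse_sum_fin : (\int[mu]_x (F x `^ p * nuw x)%:E < +oo)%E.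
Proof. by apply: (le_lt_trans sparse_sum_linearize); rewrite ltry. Qed.

Local Notation X := (fine (\int[mu]_x (F x `^ p * nuw x)%:E)).
Local Notation U Q := (fine (\int[mu]_(x in Q) (F x `^ (p - t) * nuw x)%:E)).

(** The embedding for nu with 1/s = 1 - t/p, g = F^(p-t) nu and h = F^p nu, whose integral is finite
    by [sparse_sum_fin]. The case t = p would give 1/s = 0. *)
Lemma carleson_product_weight : t < p ->
  \sum_(Q <- l) (U Q / N Q) `^ (1 - t / p)^-1 * N (E Q) <=
  carleson_const (1 - t / p)^-1 * X.
Proof.
move=> tp; have p0' := p_gt0.
have tp1 : 0 < 1 - t / p by rewrite subr_gt0 ltr_pdivrMr// mul1r.
apply: (proj2 (carleson_embedding _ _ _ _ _ _ _ _ _ _ _ _ _ _ _ _)) => //.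
- by rewrite invf_gt1// gtrBl divr_gt0.
- exact: measurable_product_weight.
- exact: product_weight_ge0.
- apply: aeW => x; rewrite invrK powRM ?powR_ge0 ?product_weight_ge0//.
  rewrite mulrCA -powRrM.
  have -> : p * (1 - t / p) = p - t by field; rewrite gt_eqF.
  rewrite ler_wpM2l ?powR_ge0// -powRD; last by rewrite subrK oner_eq0.
  by rewrite subrK powRr1// product_weight_ge0.
- move=> Q Ql; apply: cube_integral_gt0 => //; last exact: nu_fin.
  + exact: measurable_product_weight.
  + exact: product_weight_ge0.
  + exact: product_weight_gt0.
- exact: sparse_sum_fin.
Qed.

(* If [t = p], then [(1 - t / p)^-1] is the junk value [0], but the power
   [1 - t / p = 0] of the constant is [1]. *)
Definition sparse_const (b : R) : R :=
  ((2^-1 `^ (m%:R * p / p0)) `^ (t / p - b * t) *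
   carleson_const (1 - t / p)^-1 `^ (1 - t / p) *
   \prod_(i < m) carleson_const (P i / p0) `^ (t / P i)) `^ t^-1.

(** The bound [cube] is summed by [holder_sum], and the two embeddings estimate the factors. This
    leaves X <= C X^(1-t/p) times powers of the [H i]; dividing by X^(1-t/p) and taking the power
    1/t gives the claim. *)
Lemma sparse_sum_norm_le (K b : R) :
  0 <= K ->
  (forall Q, Q \in l ->
    N Q / V Q * \prod_(i < m) (S i Q / V Q) `^ (p / p0 / cj i) <= K) ->
  1 <= b -> (forall i, cj i / p <= b) ->
  X `^ p^-1 <= sparse_const b * K `^ b * \prod_(i < m) H i `^ (P i)^-1.
Proof.
move=> K0 AK b1 bcj.
have p_0 := p_gt0; have p0_0 := p0_gt0.
pose D := (2^-1 `^ (m%:R * p / p0)) `^ (t / p - b * t) * K `^ (b * t).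
have D0 : 0 <= D by rewrite mulr_ge0 ?powR_ge0.
have ta : t / p <= 1 by rewrite ler_pdivrMr// mul1r.
have ta0 : 0 <= 1 - t / p by rewrite subr_ge0.
pose lam i Q := G i Q / S i Q.
have gfin i Q : Q \in l -> (\int[mu]_(x in Q) (`|f i x| `^ p0)%:E < +oo)%E.
  by have [+ _] := carleson_dual_weight (mfun i) (f_fin i); apply.
have G0 i Q : 0 <= G i Q by rewrite fine_ge0// i0// => x; exact: powR_ge0.
have S0 i B : 0 <= S i B by rewrite fine_ge0// i0//; exact: dual_weight_ge0.
have N0 B : 0 <= N B by rewrite fine_ge0// i0//; exact: product_weight_ge0.
have U0 B : 0 <= U B by rewrite fine_ge0// i0.
have V0 Q : Q \in l -> 0 < V Q by move=> Ql; rewrite fine_gt0 ?mul.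
have NQ0 Q : Q \in l -> 0 < N Q.
  move=> Ql; rewrite fine_gt0// cube_integral_gt0 ?nu_fin//.
  - exact: measurable_product_weight.
  - exact: product_weight_ge0.
  - exact: product_weight_gt0.
have SQ0 i Q : Q \in l -> 0 < S i Q.
  move=> Ql; rewrite fine_gt0// cube_integral_gt0 ?sg_fin//.
  - exact: measurable_dual_weight.
  - exact: dual_weight_ge0.
  - exact: dual_weight_gt0.
have lam0 i Q : 0 <= lam i Q by rewrite divr_ge0.
pose Y Q := (U Q / N Q) `^ (1 - t / p)^-1 * N (E Q).
pose Z i Q := lam i Q `^ (P i / p0) * S i (E Q).
have Y0 Q : 0 <= Y Q by rewrite mulr_ge0 ?powR_ge0.
have Z0 i Q : 0 <= Z i Q by rewrite mulr_ge0 ?powR_ge0.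
have cube Q : Q \in l -> a Q `^ t * U Q <=
    D * (Y Q `^ (1 - t / p) * \prod_(i < m) Z i Q `^ (t / P i)).
  move=> Ql.
  have aE : a Q `^ t = \prod_(i < m) (S i Q / V Q) `^ (t / p0) *
      \prod_(i < m) lam i Q `^ (t / p0).
    rewrite prodr_powR => [|i]; last exact: powR_ge0.
    rewrite -big_split/=; apply: eq_bigr => i _.
    rewrite -powRrM [p0^-1 * _]mulrC -powRM ?divr_ge0 ?(ltW (V0 _ Ql))//.
    congr (_ `^ _); rewrite /lam; field.
    by rewrite !gt_eqF ?V0 ?SQ0.
  have UE : U Q = (U Q / N Q) * N Q by rewrite divfK// gt_eqF// NQ0.
  (* If t = p, the powers with exponent 0 are 1, and so is [U Q / N Q], because F^(p-t) = 1. *)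
  have YE : Y Q `^ (1 - t / p) = (U Q / N Q) * N (E Q) `^ (1 - t / p).
    rewrite /Y powRM ?powR_ge0//; congr (_ * _); rewrite -powRrM.
    have [ta1|ta1] := eqVneq (1 - t / p) 0; last first.
      by rewrite mulVf// powRr1// divr_ge0.
    rewrite ta1 mulr0 powRr0.
    have tp : t = p by move/eqP: ta1; rewrite subr_eq0 => /eqP/esym/divr1_eq.
    under eq_integral do rewrite [X in _ `^ (_ - X)]tp subrr powRr0 mul1r.
    by rewrite divff// gt_eqF// NQ0.
  have ZE i : Z i Q `^ (t / P i) = lam i Q `^ (t / p0) * S i (E Q) `^ (t / P i).
    rewrite /Z powRM ?powR_ge0//; congr (_ * _); rewrite -powRrM; congr (_ `^ _).
    by field; rewrite !gt_eqF// P_gt0.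
  rewrite aE YE {1}UE; under [X in _ <= _ * (_ * X)]eq_bigr do rewrite ZE.
  rewrite big_split/=.
  have := weight_cube_le (ml Ql) (mE Q) (EQ Ql) (mul Ql) (sparseE Ql) (nu_fin Ql)
    (fun i => sg_fin i Ql) (AK _ Ql) b1 bcj erefl; rewrite -/D.
  set L := \prod_(i < m) lam i Q `^ (t / p0).
  have L0 : 0 <= U Q / N Q * L.
    by rewrite mulr_ge0 ?divr_ge0// prodr_ge0// => i _; exact: powR_ge0.
  move=> /(ler_wpM2l L0).
  by congr (_ <= _); ring.
have XX : X <= D * (carleson_const (1 - t / p)^-1 * X) `^ (1 - t / p) *
    \prod_(i < m) (carleson_const (P i / p0) * H i) `^ (t / P i).
  have X0 : (0 <= \int[mu]_x (F x `^ p * nuw x)%:E)%E by exact: i0.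
  have : X <= \sum_(Q <- l) a Q `^ t * U Q.
    by rewrite -lee_fin fineK ?ge0_fin_numE ?sparse_sum_fin ?sparse_sum_linearize.
  move=> /le_trans; apply.
  apply: (@le_trans _ _ (\sum_(Q <- l)
     D * (Y Q `^ (1 - t / p) * \prod_(i < m) Z i Q `^ (t / P i)))).
    by rewrite big_seq [leRHS]big_seq; exact: ler_sum.
  rewrite -mulr_sumr -mulrA ler_wpM2l//.
  apply: (le_trans (@holder_sum _ _ _ l Y Z (1 - t / p) (fun i => t / P i) _ _ _ _ _)) => //.
    by move=> i; rewrite divr_ge0 ?(ltW t_gt0) ?(ltW (P_gt0 i)).
    by rewrite -mulr_sumr sumP subrK.
  apply: ler_pM; rewrite ?powR_ge0//.
  - by apply: prodr_ge0 => i _; exact: powR_ge0.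
  - have [ta1|ta1] := eqVneq (1 - t / p) 0; first by rewrite ta1 !powRr0.
    have tp : t < p.
      rewrite lt_neqAle t_lep andbT; apply: contra_neq ta1 => ->.
      by rewrite divff ?gt_eqF// subrr.
    have YX := carleson_product_weight tp.
    apply: ge0_ler_powR => //; rewrite nnegrE; first exact: sumr_ge0.
    by apply: le_trans YX; apply: sumr_ge0 => Q _; exact: Y0.
  - apply: ler_prod => i _; rewrite powR_ge0/=.
    have [_ ZH] := carleson_dual_weight (mfun i) (f_fin i).
    apply: ge0_ler_powR; rewrite ?nnegrE ?divr_ge0 ?(ltW t_gt0) ?(ltW (P_gt0 i))//.
      exact: sumr_ge0.
    by apply: le_trans ZH; apply: sumr_ge0 => Q _; exact: Z0.
have cc0 s : 1 <= s -> 0 <= carleson_const s :> R.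
  by move=> s1; rewrite divr_ge0 ?mulr_ge0 ?powR_ge0// subr_ge0.
have H0 i : 0 <= H i.
  by rewrite fine_ge0// i0// => x; rewrite mulr_ge0 ?powR_ge0.
have cP0 i : 0 <= carleson_const (P i / p0).
  by apply: cc0; rewrite ler_pdivlMr// mul1r ltW.
have [XE|XN] := eqVneq X 0.
  rewrite XE powR0 ?invr_eq0 ?gt_eqF// !mulr_ge0 ?powR_ge0//.
  by apply: prodr_ge0 => i _; exact: powR_ge0.
have X0 : 0 < X by rewrite lt0r XN fine_ge0// i0.
(* For t = p the constant is [carleson_const 0], which is negative, so the power is not distributed
   over the product; all powers then have exponent 0 and equal 1. *)
have cX : (carleson_const (1 - t / p)^-1 * X) `^ (1 - t / p) =
    carleson_const (1 - t / p)^-1 `^ (1 - t / p) * X `^ (1 - t / p).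
  have [->|ta1] := eqVneq (1 - t / p) 0; first by rewrite !powRr0 mulr1.
  rewrite powRM ?(ltW X0)//; apply: cc0; rewrite ltW// invf_gt1.
    by rewrite gtrBl divr_gt0.
  by rewrite lt0r ta1.
have Xa : X `^ (t / p) <= D * carleson_const (1 - t / p)^-1 `^ (1 - t / p) *
    \prod_(i < m) carleson_const (P i / p0) `^ (t / P i) *
    \prod_(i < m) H i `^ (t / P i).
  rewrite -(ler_pM2r (powR_gt0 (1 - t / p) X0)) -powRD; last first.
    by rewrite (gt_eqF X0) implybT.
  rewrite subrKC powRr1 ?(ltW X0)//; apply: (le_trans XX).
  rewrite cX; under eq_bigr => i _ do rewrite powRM//.
  rewrite big_split/= le_eqVlt; apply/orP; left; apply/eqP; ring.
have -> : X `^ p^-1 = (X `^ (t / p)) `^ t^-1.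
  by rewrite -powRrM; congr (_ `^ _); field; rewrite !gt_eqF.
have prod0 (c e : 'I_m -> R) : 0 <= \prod_(i < m) c i `^ e i.
  by apply: prodr_ge0 => i _; exact: powR_ge0.
have -> : sparse_const b * K `^ b * \prod_(i < m) H i `^ (P i)^-1 =
   (D * carleson_const (1 - t / p)^-1 `^ (1 - t / p) *
    \prod_(i < m) carleson_const (P i / p0) `^ (t / P i) *
    \prod_(i < m) H i `^ (t / P i)) `^ t^-1.
  rewrite powRM ?mulr_ge0 ?powR_ge0//; congr (_ * _); last first.
    rewrite prodr_powR => [|i]; last exact: powR_ge0.
    apply: eq_bigr => i _; rewrite -powRrM; congr (_ `^ _).
    by field; rewrite !gt_eqF// P_gt0.
  rewrite /sparse_const /D -[LHS]mulrC.
  have -> : K `^ b = (K `^ (b * t)) `^ t^-1.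
    by rewrite -powRrM mulfK// gt_eqF.
  rewrite -powRM ?mulr_ge0 ?powR_ge0//; congr (_ `^ _); ring.
apply: ge0_ler_powR; rewrite ?nnegrE ?invr_ge0 ?(ltW t_gt0) ?powR_ge0//.
by rewrite !mulr_ge0 ?powR_ge0.
Qed.
End finite_family.
End weights.

(** * Passage to countable families *)

Lemma ler_sum_subset (R : numDomainType) (I : eqType) (s s' : seq I) (c : I -> R) :
  uniq s -> {subset s <= s'} -> (forall i, 0 <= c i) ->
  \sum_(i <- s) c i <= \sum_(i <- s') c i.
Proof.
move=> us ss c0; elim: s s' us ss => [|x s IH] s' us ss.
  by rewrite big_nil sumr_ge0.
move: us => /= /andP[xs us].
have xs' : x \in s' by rewrite ss ?mem_head.
rewrite (perm_big _ (perm_to_rem xs')) !big_cons lerD2l IH// => y ys.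
have : y \in s' by rewrite ss// inE ys orbT.
rewrite (perm_mem (perm_to_rem xs')) inE => /predU1P[yx|//].
by move: xs; rewrite -yx ys.
Qed.

Section countable_sum.
Context d (T : measurableType d) (R : realType) (I : choiceType).
Variable mu : {measure set T -> \bar R}.

(** Monotone convergence along an exhaustion of [S] by finite lists carries the uniform bound over
    to the full sum. *)
Lemma integral_esum_powR_le (S : set I) (c : I -> T -> R) (v : T -> R) (p B : R) :
  countable S -> 0 < p -> (forall i x, 0 <= c i x) ->
  (forall i, S i -> measurable_fun [set: T] (c i)) ->
  measurable_fun [set: T] v -> (forall x, 0 <= v x) ->
  (forall l : seq I, uniq l -> (forall i, i \in l -> S i) ->
    (\int[mu]_x ((\sum_(i <- l) c i x) `^ p * v x)%:E <= B%:E)%E) ->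
  (\int[mu]_x (`|\esum_(i in S) (c i x)%:E| `^ p * (v x)%:E) <= B%:E)%E.
Proof.
move=> /countable_injP[e einj] p0 c0 mc mv v0 le_B.
pose dec j : option I :=
  if pselect (exists2 i, S i & e i = j) is left H then Some (projT1 (cid2 H)) else None.
have decE j i : dec j = Some i -> S i /\ e i = j.
  by rewrite /dec; case: pselect => // H [<-]; case: cid2.
have decK i : S i -> dec (e i) = Some i.
  move=> Si; rewrite /dec; case: pselect => [H|[]]; last by exists i.
  by congr Some; case: cid2 => k Sk /= /einj; apply; apply/mem_set.
(* The members of [S] with code below [k]; every finite part of [S] lies in one of these lists. *)
pose l k := pmap dec (iota 0 k).
have lS k i : i \in l k -> S i.
  by rewrite mem_pmap => /mapP[j _ /esym/decE[]].
have ul k : uniq (l k).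
  apply: (@pmap_uniq _ _ dec e); last exact: iota_uniq.
  by move=> j; case E : (dec j) => [i|//] /=; have [] := decE _ _ E.
have subl k k' : (k <= k')%N -> {subset l k <= l k'}.
  move=> kk' i; rewrite !mem_pmap => /mapP[j]; rewrite mem_iota add0n => /andP[_ jk] ->.
  by rewrite map_f// mem_iota add0n (leq_trans jk kk').
have fin_sub (s : seq I) : (forall i, i \in s -> S i) -> exists k, {subset s <= l k}.
  move=> sS; exists (\max_(i <- s) e i).+1 => i si.
  rewrite mem_pmap -(decK _ (sS _ si)) map_f// mem_iota add0n ltnS.
  exact: leq_bigmax_seq.
pose F k x := \sum_(i <- l k) c i x.
have F0 k x : 0 <= F k x by exact: sumr_ge0.
pose g k x := (F k x `^ p * v x)%:E.
have g0 k x : (0 <= g k x)%E by rewrite lee_fin mulr_ge0// powR_ge0.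
have mg k : measurable_fun [set: T] (g k).
  apply/measurable_EFinP; apply: measurable_funM => //; apply: measurable_fun_powR.
  have -> : F k = fun x => \sum_(i <- l k) (if i \in l k then c i x else 0).
    by apply/funext => x; apply: eq_big_seq => i il; rewrite ifT.
  by apply: measurable_sum => i; case: (boolP (i \in l k)) => // /lS; exact: mc.
have Fmono x k k' : (k <= k')%N -> F k x <= F k' x.
  by move=> kk'; apply: ler_sum_subset => //; exact: subl.
have gmono x : {homo g^~ x : k k' / (k <= k')%N >-> (k <= k')%E}.
  move=> k k' kk'; rewrite lee_fin ler_wpM2r//.
  by apply: ge0_ler_powR; rewrite ?nnegrE ?(ltW p0)// Fmono.
have Fle k x : ((F k x)%:E <= \esum_(i in S) (c i x)%:E)%E.
  apply: esum_ge; exists [set` l k]; first by split=> // i /=; exact: lS.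
  by rewrite -fsbig_seq ?ul// sumEFin.
have E0 x : (0 <= \esum_(i in S) (c i x)%:E)%E by apply: esum_ge0 => i _; rewrite lee_fin.
have limE x : limn (g^~ x) = (`|\esum_(i in S) (c i x)%:E| `^ p * (v x)%:E)%E.
  rewrite (cvg_lim _ (ereal_nondecreasing_cvgn (gmono x)))// gee0_abs//.
  have mono (y z : \bar R) : (0 <= y)%E -> (y <= z)%E -> (y `^ p <= z `^ p)%E.
    move=> y0 yz; apply: gt0_ler_poweR; rewrite ?(ltW p0)//.
      by rewrite in_itv/= y0 leey.
    by rewrite in_itv/= (le_trans y0 yz) leey.
  apply/eqP; rewrite eq_le; apply/andP; split.
    apply: ge_ereal_sup => _ [k _ <-]; rewrite /g EFinM lee_wpmul2r ?lee_fin//.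
    by rewrite -poweR_EFin mono ?lee_fin.
  (* Where [v x] vanishes the sum may be infinite, but its product with [v x] is 0. *)
  have [->|vN] := eqVneq (v x) 0.
    by rewrite mule0; apply: le_trans (g0 0%N x) _; apply: ereal_sup_ubound; exists 0%N.
  have vx : 0 < v x by rewrite lt0r vN v0.
  set L := ereal_sup _.
  have gL k : (g k x <= L)%E by apply: ereal_sup_ubound; exists k.
  have L0 : (0 <= L)%E := le_trans (g0 0%N x) (gL 0%N).
  move: L0 gL; case: L => [r||//] r0 gL; last by rewrite leey.
  have r0' : 0 <= r / v x by rewrite divr_ge0.
  (* A finite supremum [r] of the [g k x] bounds each finite partial sum by (r / v x)^(1/p). *)
  have H : (\esum_(i in S) (c i x)%:E <= ((r / v x) `^ p^-1)%:E)%E.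
    apply: ge_ereal_sup => _ [A [fA AS] <-]; rewrite fsbig_finite// sumEFin lee_fin.
    have [i|k sk] := fin_sub (finmap.enum_fset (fset_set A)).
      by rewrite in_fset_set// => /set_mem; exact: AS.
    apply: (@le_trans _ _ (F k x)).
      by apply: ler_sum_subset => //; exact: finmap.fset_uniq.
    rewrite -[leLHS](powRr1 (F0 k x)) -(divff (lt0r_neq0 p0)) powRrM.
    apply: ge0_ler_powR; rewrite ?nnegrE ?invr_ge0 ?(ltW p0) ?powR_ge0//.
    by rewrite ler_pdivlMr// -lee_fin; exact: gL.
  have := mono _ _ (E0 x) H.
  rewrite poweR_EFin -powRrM mulVf ?gt_eqF// powRr1// => {}H.
  rewrite (le_trans (lee_wpmul2r _ H)) ?lee_fin//.
  by rewrite divfK.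
under eq_integral do rewrite -limE.
rewrite monotone_convergence//.
have nd : {homo (fun k => \int[mu]_x g k x)%E : k k' / (k <= k')%N >-> (k <= k')%E}.
  by move=> k k' kk'; apply: ge0_le_integral => // x _; exact: gmono.
rewrite (cvg_lim _ (ereal_nondecreasing_cvgn nd))//.
apply: ge_ereal_sup => _ [k _ <-]; apply: le_B => //; exact: lS.
Qed.

End countable_sum.

(** * Dyadic cubes *)

Section dyadic.
Context (R : realType) (n : nat).
Variable D : set (set (Rn R n)).
Hypothesis gridD : dyadic_grid D.

Lemma dyadic_is_cube Q : D Q -> is_cube Q.
Proof.
by have [+ _ _] := gridD => /[apply] -[j Qj]; exists (2 ^ j); rewrite ?exprz_gt0.
Qed.

Lemma cube_measure Q : is_cube Q -> measurable Q /\ (0 < @leb R n Q < +oo)%E.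
Proof.
move=> [s s0 Qs]; have [mQ ->] := leb_cube (ltW s0) Qs; split=> //.
by rewrite ltry lte_fin exprn_gt0.
Qed.

Lemma dyadic_laminar (l : seq (set (Rn R n))) : (forall Q, Q \in l -> D Q) ->
  laminar l.
Proof. by have [_ + _] := gridD => nest lD A B /lD DA /lD DB; exact: nest. Qed.

(* Cubes of a given side length are disjoint and contain rational points. *)
Lemma dyadic_countable : countable D.
Proof.
have [side _ part] := gridD.
pose pt (q : {ffun 'I_n -> rat}) : Rn R n :=
  [tuple (ratr (q i) : measurableTypeR R) | i < n].
have code Q : exists z : int * {ffun 'I_n -> rat},
    D Q -> cube_of_side (2 ^ z.1) Q /\ Q (pt z.2).
  have [DQ|] := pselect (D Q); last by exists (0, [ffun=> 0]).
  have [j Qj] := side _ DQ; have [a [b [c QE]]] := Qj.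
  (* A rational point of the open cube belongs to the cube whichever faces it contains. *)
  have ex i : exists q : rat, ratr q \in `]a i, a i + 2 ^ j[.
    by apply: rat_in_itvoo; rewrite ltrDl exprz_gt0.
  have [q qP] := choice ex.
  exists (j, [ffun i => q i]) => _; split=> //=.
  rewrite QE /= => i; rewrite tnth_mktuple ffunE.
  have := qP i; rewrite !itv_boundlr /= => /andP[h1 h2].
  apply/andP; split.
    by move: h1; case: (b i); rewrite !bnd_simp// => /ltW.
  by move: h2; case: (c i); rewrite !bnd_simp// => /ltW.
have [z zP] := choice code.
apply/countable_injP; exists (pickle \o z) => A B /set_mem DA /set_mem DB /=.
move=> /(pcan_inj pickleK) zAB.
have [Aj Ax] := zP _ DA; have [Bj Bx] := zP _ DB.
have [_ /trivIsetP tr _] := part (z A).1.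
apply: contrapT => /eqP AB.
have := tr A B (conj DA Aj); rewrite {1}zAB => /(_ (conj DB Bj) AB).
move=> /seteqP[/(_ (pt (z A).2)) + _]; apply; split=> //.
by rewrite zAB.
Qed.

End dyadic.

(** * Finiteness of the weight averages from finiteness of the weight constant *)

Lemma mule_gt0_fin (R : realType) (x y : \bar R) : (0 < x)%E -> (0 < y)%E ->
  (x * y < +oo)%E -> (x < +oo)%E /\ (y < +oo)%E.
Proof.
move: x y => [x| |] [y| |]//=; rewrite ?ltry//.
- by rewrite lte_fin => x0 _; rewrite mulr_infty gtr0_sg// mul1e ltxx.
- by rewrite lte_fin => _ y0; rewrite mulr_infty gtr0_sg// mul1e ltxx.
Qed.

(** Strict positivity rules out 0 * +oo = 0, the way an infinite factor could hide in a finite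
    product. *)
Lemma prode_gt0_fin (R : realType) (I : finType) (x : I -> \bar R) :
  (forall i, 0 < x i)%E -> (\prod_i x i < +oo)%E -> forall i, (x i < +oo)%E.
Proof.
move=> x0 + i; rewrite (bigD1 i)//= => /mule_gt0_fin[]//.
by apply: (big_ind (fun z : \bar R => 0 < z)%E) => // y z y0 z0; exact: mule_gt0.
Qed.

Section weights_Rn.
Context (R : realType) (n m : nat) (p0 p : R) (P : 'I_m -> R).
Hypotheses (m_gt0 : (0 < m)%N) (p0_ge1 : 1 <= p0).
Hypotheses (p0P : forall i, p0 < P i) (sumP : \sum_(i < m) (P i)^-1 = p^-1).
Variable w : 'I_m -> Rn R n -> R.
Hypotheses (weight_w : forall i, weight (w i)) (A_fin : (A_const p p0 P w < +oo)%E).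
Local Notation mu := (@leb R n).

Let mw i : measurable_fun [set: Rn R n] (w i). Proof. by case: (weight_w i). Qed.
Let w_ge0 i x : 0 <= w i x. Proof. by case: (weight_w i). Qed.
Let w_gt0 i : \forall x \ae mu, 0 < w i x. Proof. by case: (weight_w i). Qed.

(** All averages over [Q] are strictly positive, so their finite product forces each of them to be
    finite; only then do the values under [fine] represent the integrals. *)
Lemma A_const_cube Q : is_cube Q ->
  [/\ (\int[mu]_(x in Q) (product_weight p P w x)%:E < +oo)%E,
      forall i, (\int[mu]_(x in Q) (dual_weight p0 P w i x)%:E < +oo)%E &
      fine (\int[mu]_(x in Q) (product_weight p P w x)%:E) / fine (mu Q) *
      \prod_(i < m) (fine (\int[mu]_(x in Q) (dual_weight p0 P w i x)%:E) /
        fine (mu Q)) `^ (p / p0 / conj_exp (P i / p0)) <=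
      fine (A_const p p0 P w)].
Proof.
move=> cQ; have [mQ Q0] := cube_measure cQ.
have V0 : 0 < (fine (mu Q))^-1 by rewrite invr_gt0 fine_gt0.
have Q00 : (0 < mu Q)%E by have /andP[] := Q0.
set c := fun i => p / p0 / conj_exp (P i / p0).
set In := (\int[mu]_(x in Q) (product_weight p P w x)%:E)%E.
pose Is i := (\int[mu]_(x in Q) (dual_weight p0 P w i x)%:E)%E.
have c0 i : c i != 0.
  have cj0 : 0 < conj_exp (P i / p0).
    by apply: lt_trans ltr01 _; exact: conj_exp_gt1 (p0_gt0 p0_ge1) (p0P i).
  rewrite gt_eqF//; apply: divr_gt0 cj0; apply: divr_gt0 (p0_gt0 p0_ge1).
  exact: p_gt0 m_gt0 p0_ge1 p0P sumP.
have In0 : (0 < In)%E.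
  apply: integral_gt0_ae => //.
  - exact: measurable_product_weight.
  - by move=> x; exact: product_weight_ge0.
  - exact: product_weight_gt0.
have Is0 i : (0 < Is i)%E.
  apply: integral_gt0_ae => //.
  - exact: measurable_dual_weight.
  - by move=> x; exact: dual_weight_ge0.
  - exact: dual_weight_gt0.
have AQ : ((fine (mu Q))^-1%:E * In *
    \prod_(i < m) ((fine (mu Q))^-1%:E * Is i) `^ c i <= A_const p p0 P w)%E.
  by apply: ereal_sup_ubound; exists Q.
have prod0 : (0 < \prod_(i < m) ((fine (mu Q))^-1%:E * Is i) `^ c i)%E.
  apply: (big_ind (fun z : \bar R => 0 < z)%E) => // [y z|i _]; first exact: mule_gt0.
  by rewrite poweR_gt0// mule_gt0.
have Vn0 : (0 < (fine (mu Q))^-1%:E * In)%E by rewrite mule_gt0.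
have [Vn_fin prod_fin] := mule_gt0_fin Vn0 prod0 (le_lt_trans AQ A_fin).
have VE0 : (0 < (fine (mu Q))^-1%:E)%E by rewrite lte_fin.
have In_fin : (In < +oo)%E := (mule_gt0_fin VE0 In0 Vn_fin).2.
(* The exponent [c i] is nonzero, so an infinite integral would keep its power infinite. *)
have Is_fin i : (Is i < +oo)%E.
  have pw_gt0 j : (0 < ((fine (mu Q))^-1%:E * Is j) `^ c j)%E.
    by rewrite poweR_gt0// mule_gt0.
  have := prode_gt0_fin pw_gt0 prod_fin i.
  rewrite !ltey; apply: contra_neq => ->.
  by rewrite gt0_muley// poweRyr.
split=> //.
have InE : In = (fine In)%:E by rewrite fineK// ge0_fin_numE// ltW.
have IsE i : Is i = (fine (Is i))%:E by rewrite fineK// ge0_fin_numE// ltW.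
rewrite -lee_fin fineK; last first.
  by rewrite ge0_fin_numE// (le_trans _ AQ)// ltW// mule_gt0.
apply: le_trans AQ; rewrite InE.
under [X in (_ <= _ * X)%E]eq_bigr => i _ do rewrite IsE -EFinM poweR_EFin.
rewrite prodEFin -!EFinM lee_fin.
rewrite le_eqVlt; apply/orP; left; apply/eqP; congr (_ * _); first exact: mulrC.
by apply: eq_bigr => i _; congr (_ `^ _); exact: mulrC.
Qed.

End weights_Rn.

(** * From finite subfamilies to the sparse operator on R^n *)

Theorem theorem2 (R : realType) (n m : nat) (p0 p : R) (P : 'I_m -> R)
    (hn : (1 <= n)%N) (hm : (1 <= m)%N) (hp0 : 1 <= p0)
    (hP : forall i, p0 < P i) (hp : \sum_(i < m) (P i)^-1 = p^-1) :
  exists C : R,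
    forall (D S : set (set (Rn R n))) (w f : 'I_m -> Rn R n -> R),
      dyadic_grid D -> sparse D S ->
      (forall i, weight (w i)) -> (A_const p p0 P w < +oo)%E ->
      (forall i, weighted_Lp (P i) (w i) (f i)) ->
      (weighted_norm p (nu p P w) (sparse_operator p0 S f) <=
        C%:E *
        A_const p p0 P w `^
          (\big[Num.max/1]_(i < m) (conj_exp (P i / p0) / p))%R *
        \prod_(i < m) weighted_norm (P i) (w i) (EFin \o f i))%E.
Proof.
set b := (\big[Num.max/1]_(i < m) (conj_exp (P i / p0) / p))%R.
exists (sparse_const p0 p P b) => D S w f gridD [SD [E [mE tE sparseE]]] ww A_fin fLp.
have p_0 := p_gt0 hm hp0 hP hp; have p0_0 := p0_gt0 hp0.
pose mu : {measure set (Rn R n) -> \bar R} := @leb R n.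
have P0 i : 0 < P i by exact: P_gt0 hp0 hP i.
have mw i : measurable_fun [set: Rn R n] (w i) by case: (ww i).
have w_ge0 i x : 0 <= w i x by case: (ww i).
have w_gt0 i : \forall x \ae mu, 0 < w i x by case: (ww i).
have mfun i : measurable_fun [set: Rn R n] (f i) by case: (fLp i).
have cubeS Q : S Q -> is_cube Q by move=> /SD; exact: dyadic_is_cube.
have mS Q : S Q -> measurable Q by move=> /cubeS/cube_measure[].
have muS Q : S Q -> (0 < mu Q < +oo)%E by move=> /cubeS/cube_measure[].
have ASb Q : S Q -> _ := fun SQ => A_const_cube hm hp0 hP hp ww A_fin (cubeS Q SQ).
have b1 : 1 <= b by exact: bigmax_ge_id.
have bcj i : conj_exp (P i / p0) / p <= b by apply: le_bigmax_cond.
pose H i := (\int[mu]_x (`|f i x| `^ P i * w i x)%:E)%E.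
have normE i : weighted_norm (P i) (w i) (EFin \o f i) = (H i `^ (P i)^-1)%E by [].
have H0 i : (0 <= H i)%E.
  by apply: integral_ge0 => x _; rewrite lee_fin mulr_ge0 ?powR_ge0.
have H_fin i : (H i < +oo)%E.
  have [_] := fLp i; rewrite normE ltey => Hi; rewrite ltey.
  by apply: contra_neq Hi => ->; rewrite poweRyr// invr_eq0 gt_eqF.
(* Nothing is known about [E] outside [S]; the empty value there makes all the sets measurable, as
   the finite estimates require. *)
pose E' Q := if pselect (S Q) then E Q else set0.
have mE' Q : measurable (E' Q).
  by rewrite /E'; case: pselect => [SQ|NSQ]; [have [] := mE _ SQ|exact: measurable0].
have E'E Q : S Q -> E' Q = E Q by rewrite /E'; case: pselect.
have A0 : (0 <= A_const p p0 P w)%E.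
  (* The unit cube shows that the supremum is over a nonempty set, so it is at least a nonnegative
     number and not -oo. *)
  pose Q0 : set (Rn R n) := [set x | forall i, (tnth x i : R) \in
    Interval (BSide true 0) (BSide true (0 + 1))].
  have cQ0 : is_cube Q0.
    by exists 1 => //; exists (fun=> 0), (fun=> true), (fun=> true).
  apply: le_trans (ereal_sup_ubound _); last by exists Q0.
  have avg0 u : (forall x, 0 <= u x) -> (0 <= average Q0 u)%E.
    move=> u0; rewrite mule_ge0 ?lee_fin ?invr_ge0 ?fine_ge0//.
    by apply: integral_ge0 => x _; rewrite lee_fin.
  rewrite mule_ge0//; first by apply: avg0 => x; exact: product_weight_ge0.
  by apply: prode_ge0 => i _; exact: poweR_ge0.
set K := fine (A_const p p0 P w).
have K0 : 0 <= K by exact: fine_ge0.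
have KE : A_const p p0 P w = K%:E by rewrite /K fineK// ge0_fin_numE.
set B := sparse_const p0 p P b * K `^ b * \prod_(i < m) fine (H i) `^ (P i)^-1.
have finite_le (l : seq (set (Rn R n))) : uniq l -> (forall Q, Q \in l -> S Q) ->
    (forall Q i, Q \in l -> paverage p0 Q (f i) =
       (((fine (mu Q))^-1 * fine (\int[mu]_(x in Q) (`|f i x| `^ p0)%:E)) `^ p0^-1)%:E) /\
    (\int[mu]_x (sparse_sum mu p0 l f x `^ p * product_weight p P w x)%:E
    <= (B `^ p)%:E)%E.
  move=> ul lS.
  have laml : laminar l by apply: (dyadic_laminar gridD) => Q /lS/SD.
  have ml Q : Q \in l -> measurable Q by move=> /lS/mS.
  have mul Q : Q \in l -> (0 < mu Q < +oo)%E by move=> /lS/muS.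
  have nul Q : Q \in l -> (\int[mu]_(x in Q) (product_weight p P w x)%:E < +oo)%E.
    by move=> /lS/ASb[].
  have sgl Q i : Q \in l -> (\int[mu]_(x in Q) (dual_weight p0 P w i x)%:E < +oo)%E.
    by move=> /lS/ASb[].
  have El Q : Q \in l -> E' Q `<=` Q.
    by move=> /lS SQ; rewrite E'E//; have [] := mE _ SQ.
  have tl : trivIset [set` l] E'.
    by move=> A A' /lS SA /lS SA'; rewrite !E'E//; exact: tE.
  have spl Q : Q \in l -> (mu Q <= 2%:E * mu (E' Q))%E.
    by move=> /lS SQ; rewrite E'E//; exact: sparseE.
  split.
    move=> Q i Ql.
    have [gf _] := carleson_dual_weight hp0 hP mw w_ge0 w_gt0 ul laml ml mul mE' El
      tl sgl (mfun i) (H_fin i).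
    rewrite /paverage /average -poweR_EFin EFinM fineK// ge0_fin_numE ?gf//.
    by apply: integral_ge0 => x _; rewrite lee_fin powR_ge0.
  have X_fin := sparse_sum_fin hm hp0 hP hp mw ml nul f.
  have X0 : (0 <= \int[mu]_x (sparse_sum mu p0 l f x `^ p * product_weight p P w x)%:E)%E.
    apply: integral_ge0 => x _; rewrite lee_fin mulr_ge0 ?powR_ge0//.
    exact: product_weight_ge0.
  have := sparse_sum_norm_le hm hp0 hP hp mw w_ge0 w_gt0 ul laml ml mul mE' El tl
    spl nul sgl mfun H_fin K0 (fun Q Ql => let: And3 _ _ h := ASb Q (lS Q Ql) in h)
    b1 bcj.
  rewrite -/B => XB.
  rewrite -[leLHS]fineK ?ge0_fin_numE// lee_fin.
  rewrite -[leLHS]powRr1 ?fine_ge0// -(mulVf (lt0r_neq0 p_0)) powRrM.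
  apply: ge0_ler_powR; rewrite ?nnegrE ?(ltW p_0) ?powR_ge0//.
  by rewrite (le_trans _ XB)// powR_ge0.
pose c Q x := sparse_coef mu p0 f Q * \1_Q x.
have spE x : sparse_operator p0 S f x = \esum_(Q in S) (c Q x)%:E.
  apply: eq_esum => Q SQ; rewrite /c EFinM; congr (_ * _)%E.
  (* The family consisting of [Q] alone already shows that the averages over [Q] are finite. *)
  have [|pE _] := finite_le [:: Q] isT; first by move=> A; rewrite inE => /eqP->.
  rewrite /sparse_coef -prodEFin; apply: eq_bigr => i _.
  by rewrite pE// mem_head.
have main : (\int[mu]_x (`|sparse_operator p0 S f x| `^ p * (nu p P w x)%:E)
    <= (B `^ p)%:E)%E.
  under eq_integral do rewrite spE.
  apply: integral_esum_powR_le => //.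
  - by apply: sub_countable (dyadic_countable gridD); exact: subset_card_le.
  - by move=> Q x; rewrite mulr_ge0 ?sparse_coef_ge0.
  - move=> Q SQ; apply: measurable_funM => //.
    by apply: measurable_indic; exact: mS.
  - exact: measurable_product_weight.
  - by move=> x; exact: product_weight_ge0.
  - by move=> l ul lS; have [_] := finite_le l ul lS.
have B0 : 0 <= B.
  by rewrite !mulr_ge0 ?powR_ge0// prodr_ge0// => i _; exact: powR_ge0.
have -> : (\prod_(i < m) weighted_norm (P i) (w i) (EFin \o f i) =
    (\prod_(i < m) fine (H i) `^ (P i)^-1)%:E)%E.
  rewrite -prodEFin; apply: eq_bigr => i _; rewrite normE -poweR_EFin fineK//.
  by rewrite ge0_fin_numE.
rewrite KE poweR_EFin -!EFinM -/B /weighted_norm.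
apply: (@le_trans _ _ ((B `^ p)%:E `^ p^-1)%E).
  apply: gt0_ler_poweR => //; first by rewrite invr_ge0 ltW.
  - rewrite in_itv/= leey andbT; apply: integral_ge0 => x _.
    by rewrite mule_ge0 ?poweR_ge0// lee_fin; exact: product_weight_ge0.
  - by rewrite in_itv/= leey andbT lee_fin powR_ge0.
by rewrite poweR_EFin -powRrM divff ?gt_eqF// powRr1.
Qed.
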